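(* For every parity-class triple $\mathcal{T}\ne(1,1,2)$ one has $\mathrm{Szp}(J_{\mathcal{T}})<3$, where $J_{\mathcal{T}}$ is the Jacobian of the parity descent curve $\mathscr{D}_{\mathcal{T}}$. More precisely, writing $\gamma=\gamma_{\mathcal{T}}$, $$\mathrm{Szp}(J_{\mathcal{T}})=\begin{cases}3-\dfrac{9\log2}{2\log\gamma+5\log2}&\gamma\text{ odd},\\[1.2em]3-\dfrac{6\log2}{2\log\gamma+4\log2}&\gamma\text{ even}.\end{cases}$$
   Context: A parity-class triple is a triple $\mathcal{T}=(a,b,c)$ of pairwise coprime positive integers with $a+b=c$, $a$ and $b$ odd, $c$ even. Put $K=(a+b)/2$ and $M=(b-a)/2$. Write $a=d_au_a^2$ and $b=d_bu_b^2$ with $d_a,d_b$ positive squarefree integers and $u_a,u_b$ positive integers. For $\mathcal{T}\neq(1,1,2)$ (equivalently $M\ne0$), the parity descent curve $\mathscr{D}_{\mathcal{T}}\subset\mathbb{P}^3_{(U:V:W:T)}$ over $\mathbb{Q}$ is the smooth genus-one intersection of the two quadrics $d_aU^2+d_bV^2=2KW^2$ and $d_bV^2-d_aU^2=2MT^2$. Put $\Gamma_{\mathcal{T}}=d_ad_bKM$ and let $\gamma_{\mathcal{T}}$ be the squarefree part of $|\Gamma_{\mathcal{T}}|$, i.e. $|\Gamma_{\mathcal{T}}|$ divided by its largest square divisor. The Jacobian $J_{\mathcal{T}}$ of $\mathscr{D}_{\mathcal{T}}$ is the elliptic curve $y^2=x^3-16\Gamma_{\mathcal{T}}^2x$, isomorphic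 over $\mathbb{Q}$ to $Y^2=X^3-\gamma_{\mathcal{T}}^2X$. For an elliptic curve $E/\mathbb{Q}$ with minimal discriminant $\Delta_{\min}(E)$ and conductor $N_E>1$, the Szpiro quotient is $\mathrm{Szp}(E)=\log|\Delta_{\min}(E)|/\log N_E$. *)

(* Defs.v *)
From HB Require Import structures.
From mathcomp Require Import all_boot all_order all_algebra all_fingroup all_field.
From mathcomp Require Import ring lra.
From mathcomp Require Import all_classical all_reals all_analysis.

Set Implicit Arguments.
Unset Strict Implicit.
Unset Printing Implicit Defensive.

Import Order.TTheory GRing.Theory Num.Theory.
Local Open Scope ring_scope.

(** * Weierstrass curves *)

(* [y^2 + a1 x y + a3 y = x^3 + a2 x^2 + a4 x + a6]; nonsingularity is not
   part of the structure. *)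
Record wcurve (R : Type) : Type :=
  WCurve { wa1 : R; wa2 : R; wa3 : R; wa4 : R; wa6 : R }.

Definition map_wcurve (R S : Type) (f : R -> S) (E : wcurve R) : wcurve S :=
  WCurve (f (wa1 E)) (f (wa2 E)) (f (wa3 E)) (f (wa4 E)) (f (wa6 E)).

Definition wdisc (R : comNzRingType) (E : wcurve R) : R :=
  let: WCurve a1 a2 a3 a4 a6 := E in
  let b2 := a1 ^+ 2 + 4 * a2 in
  let b4 := 2 * a4 + a1 * a3 in
  let b6 := a3 ^+ 2 + 4 * a6 in
  let b8 := a1 ^+ 2 * a6 + 4 * a2 * a6 - a1 * a3 * a4 + a2 * a3 ^+ 2
            - a4 ^+ 2 in
  - b2 ^+ 2 * b8 - 8 * b4 ^+ 3 - 27 * b6 ^+ 2 + 9 * b2 * b4 * b6.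

(* The equation satisfied by [(x', y')], where [x = u^2 x' + r] and
   [y = u^3 y' + u^2 s x' + t]. *)
Definition wchange (F : fieldType) (u r s t : F) (E : wcurve F) : wcurve F :=
  let: WCurve a1 a2 a3 a4 a6 := E in
  WCurve ((a1 + 2 * s) / u)
         ((a2 - s * a1 + 3 * r - s ^+ 2) / u ^+ 2)
         ((a3 + r * a1 + 2 * t) / u ^+ 3)
         ((a4 - s * a3 + 2 * r * a2 - (t + r * s) * a1 + 3 * r ^+ 2
           - 2 * s * t) / u ^+ 4)
         ((a6 + r * a4 + r ^+ 2 * a2 + r ^+ 3 - t * a3 - t ^+ 2
           - r * t * a1) / u ^+ 6).

Definition wisomorphic (F : fieldType) (E E' : wcurve F) : Prop :=
  exists u r s t : F, u != 0 /\ E' = wchange u r s t E.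

(** * Minimal discriminant *)

Definition integral_model (E : wcurve rat) (W : wcurve int) : Prop :=
  wisomorphic E (map_wcurve (fun n : int => n%:~R) W).

Definition minimal_model (E : wcurve rat) (W : wcurve int) : Prop :=
  integral_model E W /\
  forall W' : wcurve int, integral_model E W' -> `|wdisc W| <= `|wdisc W'|.

Definition minimal_discriminant (E : wcurve rat) (D : int) : Prop :=
  exists2 W : wcurve int, minimal_model E W & D = wdisc W.

(** * Points and the group law *)

(* [None] is the point at infinity. *)
Definition wpoint (F : Type) : Type := option (F * F).

Definition on_wcurve (F : fieldType) (E : wcurve F) (P : wpoint F) : bool :=
  let: WCurve a1 a2 a3 a4 a6 := E in
  if P is Some (x, y) then
    y ^+ 2 + a1 * x * y + a3 * y == x ^+ 3 + a2 * x ^+ 2 + a4 * x + a6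
  else true.

Definition wadd (F : fieldType) (E : wcurve F) (P Q : wpoint F) : wpoint F :=
  let: WCurve a1 a2 a3 a4 a6 := E in
  match P, Q with
  | None, _ => Q
  | _, None => P
  | Some (x1, y1), Some (x2, y2) =>
      if (x1 == x2) && (y1 + y2 + a1 * x2 + a3 == 0) then None
      else
        let l := if x1 == x2 then
                   (3 * x1 ^+ 2 + 2 * a2 * x1 + a4 - a1 * y1)
                   / (2 * y1 + a1 * x1 + a3)
                 else (y2 - y1) / (x2 - x1) in
        let x3 := l ^+ 2 + a1 * l - a2 - x1 - x2 in
        Some (x3, - (l + a1) * x3 - (y1 - l * x1) - a3)
  end.

Definition wmuln (F : fieldType) (E : wcurve F) (n : nat) (P : wpoint F) :
  wpoint F := iter n (wadd E P) None.

(** * Conductor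

    The exponent at [p] is [eps + delta].  The tame part [eps] is 0, 1 or 2
    according to whether the reduction at [p] of a minimal model is smooth,
    nodal or cuspidal.  The wild part is
      [delta = \sum_(i >= 1) #|G_i| / #|G_0| * dim (E[l] / E[l]^(G_i))],
    where [l <> p] is prime and the [G_i] are the ramification groups, in the
    lower numbering, of [Q(E[l])] at a place above [p]. *)

Definition wsingular (F : fieldType) (E : wcurve F) (x y : F) : bool :=
  let: WCurve a1 a2 a3 a4 a6 := E in
  [&& on_wcurve E (Some (x, y)),
      2 * y + a1 * x + a3 == 0 &
      a1 * y == 3 * x ^+ 2 + 2 * a2 * x + a4].

(* At a singular point [(x, y)] the tangent cone is
   [Y^2 + a1 X Y - (a2 + 3 x) X^2]; it splits into two distinct lines iff this
   discriminant is nonzero. *)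
Definition wnode (F : fieldType) (E : wcurve F) (x y : F) : bool :=
  wsingular E x y && (wa1 E ^+ 2 + 4 * (wa2 E + 3 * x) != 0).

(* The singular point of a singular cubic over the perfect field ['F_p] is
   rational, so it is enough to look for it over ['F_p] itself. *)
Definition tame_exponent (W : wcurve int) (p : nat) : nat :=
  let Wp := map_wcurve (fun n : int => n%:~R : 'F_p) W in
  if ~~ [exists x, exists y, wsingular Wp x y] then 0%N
  else if [exists x, exists y, wnode Wp x y] then 1%N
  else 2%N.

(* A discrete valuation of [L] above [p] with value group [int].  The value
   [v 0] is irrelevant and stands for [+oo], see [val_ge]. *)
Definition normalized_valuation (L : fieldType) (p : nat) (v : L -> int) :
  Prop :=
  [/\ forall x y, x != 0 -> y != 0 -> v (x * y) = v x + v y,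
      forall x y, x != 0 -> y != 0 -> x + y != 0 ->
        Num.min (v x) (v y) <= v (x + y),
      exists2 x, x != 0 & v x = 1
    & p%:R != 0 :> L /\ 0 < v p%:R].

Definition val_ge (L : fieldType) (v : L -> int) (n : nat) (x : L) : bool :=
  (x == 0) || (n%:Z <= v x).

(* Since [s] preserves the place [v] as soon as [s] lies in one of these sets,
   they are the ramification groups of the completion of [L] at [v]. *)
Definition ramification_group (L : splittingFieldType rat) (v : L -> int)
    (i : nat) : {set gal_of {:L}} :=
  [set s in 'Gal({:L} / 1)%g
     | `[< forall x : L, val_ge v 0 x -> val_ge v i.+1 (s x - x) >]].

(* [L] is the field generated over [Q] by the coordinates of the [l]-torsion
   points, and [T] lists these points, which are [l ^ 2] in number. *)
Definition torsion_field (E : wcurve rat) (l : nat)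
    (L : splittingFieldType rat) (T : seq (wpoint L)) : Prop :=
  let EL := map_wcurve (fun a : rat => a%:A : L) E in
  [/\ uniq T,
      size T = (l ^ 2)%N,
      {in T, forall P, on_wcurve EL P /\ wmuln EL l P = None}
    & <<1 & flatten [seq if P is Some (x, y) then [:: x; y] else [::]
                    | P <- T]>>%VS = fullv].

Definition fixed_points (L : splittingFieldType rat) (T : seq (wpoint L))
    (G : {set gal_of {:L}}) : seq (wpoint L) :=
  [seq P <- T | [forall s in G, omap (fun xy => (s xy.1, s xy.2)) P == P]].

(* The fixed points form an ['F_l]-space, whose dimension is [logn l] of its
   cardinal.  The groups decrease, so the terms [i >= n] of the sum vanish as
   soon as the [n]-th group is trivial. *)
Definition wild_exponent (E : wcurve rat) (p l : nat) (delta : rat) : Prop :=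
  exists (L : splittingFieldType rat) (T : seq (wpoint L)) (v : L -> int)
         (n : nat),
    [/\ torsion_field E l T,
        normalized_valuation p v,
        ramification_group v n = [set 1%g]
      & let G := ramification_group v in
        delta = \sum_(1 <= i < n)
          #|G i|%:R / #|G 0|%:R * (2 - logn l (size (fixed_points T (G i))))%:R].

(* The wild part does not depend on the auxiliary prime [l <> p]; the smallest
   one is used. *)
Definition conductor_exponent (E : wcurve rat) (W : wcurve int) (p f : nat) :
  Prop :=
  exists2 delta : rat,
    wild_exponent E p (if p == 2%N then 3%N else 2%N) delta
  & f%:R = (tame_exponent W p)%:R + delta.

Definition conductor (E : wcurve rat) (N : nat) : Prop :=
  exists2 W : wcurve int, minimal_model E W
  & exists2 f : nat -> nat,
      {in primes `|wdisc W|%N, forall p, conductor_exponent E W p (f p)}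
    & N = (\prod_(p <- primes `|wdisc W|%N) p ^ f p)%N.

Definition szpiro_quotient (R : realType) (E : wcurve rat) (q : R) : Prop :=
  exists (D : int) (N : nat),
    [/\ minimal_discriminant E D, conductor E N
      & q = ln (`|D|%:~R) / ln (N%:R)].

(** * Jacobian of an intersection of two quadrics *)

(* The curve [{x A x^T = 0, x B x^T = 0}] in [P^3]. *)
Record quadric_pair : Type :=
  QuadricPair { quadA : 'M[rat]_4; quadB : 'M[rat]_4 }.

Definition on_quadric_pair (F : fieldType) (f : rat -> F) (C : quadric_pair)
    (x : 'rV[F]_4) : Prop :=
  [/\ x != 0, x *m map_mx f (quadA C) *m x^T = 0
    & x *m map_mx f (quadB C) *m x^T = 0].

(* Weil: a smooth intersection of two quadrics has the same Jacobian as
   [y^2 = g(x) = det (x A - B) = a x^4 + b x^3 + c x^2 + d x + e], namely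
   [y^2 = x^3 - 27 I x - 27 J] with [I], [J] the invariants of [g], that is
   [y^2 = x^3 - (I / 3) x - J / 27] after rescaling. *)
Definition quadric_jacobian (C : quadric_pair) : wcurve rat :=
  let g := \det ('X *: map_mx polyC (quadA C) - map_mx polyC (quadB C)) in
  let a := g`_4 in let b := g`_3 in let c := g`_2 in
  let d := g`_1 in let e := g`_0 in
  let I := 12 * a * e - 3 * b * d + c ^+ 2 in
  let J := 72 * a * c * e + 9 * b * c * d - 27 * a * d ^+ 2
           - 27 * e * b ^+ 2 - 2 * c ^+ 3 in
  WCurve 0 0 0 (- (I / 3)) (- (J / 27)).

(** * Parity-class triples *)

Definition parity_class_triple (a b c : nat) : Prop :=
  [/\ [/\ (0 < a)%N, (0 < b)%N & (0 < c)%N],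
      [/\ coprime a b, coprime a c & coprime b c],
      (a + b)%N = c
    & [/\ odd a, odd b & ~~ odd c]].

Definition squarefree (n : nat) : Prop :=
  (0 < n)%N /\ forall k : nat, (k ^ 2 %| n)%N -> k = 1%N.

Definition squarefree_decomposition (n d u : nat) : Prop :=
  [/\ squarefree d, (0 < u)%N & n = (d * u ^ 2)%N].

(* [n] divided by its largest square divisor, for [n > 0]. *)
Definition squarefree_part (n : nat) : nat :=
  (n %/ \max_(k < n.+1 | (k ^ 2 %| n)%N) k ^ 2)%N.

(* Both divisions are exact when [a] and [b] are odd. *)
Definition parityK (a b : nat) : int := ((a%:Z + b%:Z) %/ 2)%Z.
Definition parityM (a b : nat) : int := ((b%:Z - a%:Z) %/ 2)%Z.

(* In coordinates [(U : V : W : T)]: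
   [da U^2 + db V^2 = 2 K W^2] and [db V^2 - da U^2 = 2 M T^2]. *)
Definition parity_descent_curve (a b da db : nat) : quadric_pair :=
  let K := (parityK a b)%:~R : rat in
  let M := (parityM a b)%:~R : rat in
  QuadricPair
    (diag_mx (\row_(j < 4) [:: da%:R; db%:R; - (2 * K); 0]`_j))
    (diag_mx (\row_(j < 4) [:: - da%:R; db%:R; 0; - (2 * M)]`_j)).

Definition parityGamma (a b da db : nat) : int :=
  da%:Z * db%:Z * parityK a b * parityM a b.

Lemma on_parity_descent_curveE (F : fieldType) (f : {rmorphism rat -> F})
    (a b da db : nat) (U V W T : F) :
  let K := (parityK a b)%:~R : F in
  let M := (parityM a b)%:~R : F in
  on_quadric_pair f (parity_descent_curve a b da db)
    (\row_(j < 4) [:: U; V; W; T]`_j) <->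
  [/\ [|| U != 0, V != 0, W != 0 | T != 0],
      da%:R * U ^+ 2 + db%:R * V ^+ 2 = 2 * K * W ^+ 2
    & db%:R * V ^+ 2 - da%:R * U ^+ 2 = 2 * M * T ^+ 2].
Proof.
move=> K M; set x := \row_j _.
have qf (d : seq rat) :
    x *m map_mx f (diag_mx (\row_(j < 4) d`_j)) *m x^T =
    (f d`_0 * U ^+ 2 + f d`_1 * V ^+ 2 + f d`_2 * W ^+ 2
     + f d`_3 * T ^+ 2)%:M.
  rewrite map_diag_mx mul_mx_diag; apply/matrixP => i j.
  rewrite !ord1 !mxE !big_ord_recl big_ord0 !mxE /=.
  by rewrite mulr1n; ring.
have sc0 (z : F) : z%:M = 0 :> 'M[F]_1 <-> z = 0.
  by split=> [/matrixP/(_ 0 0)|->]; rewrite ?mxE ?mulr1n ?raddf0.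
have x0 : (x != 0) = [|| U != 0, V != 0, W != 0 | T != 0].
  rewrite -!negb_and; congr (~~ _); apply/eqP/and4P => [/rowP h|].
    have := (h 0, h 1, h 2, h 3); rewrite !mxE /= => -[[[-> ->] ->] ->].
    by rewrite eqxx.
  case=> /eqP U0 /eqP V0 /eqP W0 /eqP T0; apply/rowP => j.
  by rewrite !mxE U0 V0 W0 T0; case: j => -[|[|[|[|]]]].
rewrite /on_quadric_pair /parity_descent_curve {}/K {}/M.
move: (parityK a b) (parityM a b) => k m.
rewrite /quadA /quadB !qf x0 /= !rmorphN !rmorphM !rmorph_nat rmorph0.
rewrite !rmorph_int.
have subE (z w : F) : z - w = 0 <-> z = w.
  by split=> [/eqP|->]; rewrite ?subrr// subr_eq0 => /eqP.
split=> -[xN0 hA hB]; split=> //.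
- by move/sc0: hA => hA; apply/subE; rewrite -[RHS]hA; ring.
- by move/sc0: hB => hB; apply/subE; rewrite -[RHS]hB; ring.
- by apply/sc0; move/subE: hA => hA; rewrite -[RHS]hA; ring.
- by apply/sc0; move/subE: hB => hB; rewrite -[RHS]hB; ring.
Qed.

Lemma quadric_jacobian_parity_descent_curve (a b da db : nat) :
  quadric_jacobian (parity_descent_curve a b da db) =
  WCurve 0 0 0 (- (16 * (parityGamma a b da db)%:~R ^+ 2)) 0.
Proof.
rewrite /quadric_jacobian; set g := \det _.
set G := (parityGamma a b da db)%:~R : rat.
have -> : g = (4 * G) *: 'X - (4 * G) *: 'X^3.
  have -> : G = da%:R * db%:R * (parityK a b)%:~R * (parityM a b)%:~R.
    by rewrite /G /parityGamma !intrM.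
  rewrite /g /parity_descent_curve /quadA /quadB.
  move: (da%:R : rat) (db%:R : rat) ((parityK a b)%:~R : rat)
    ((parityM a b)%:~R : rat) => x y k m.
  rewrite !map_diag_mx -linearZ -linearB det_diag.
  rewrite !big_ord_recl big_ord0 !mxE /= -!mul_polyC.
  rewrite !polyCN !polyCM !polyC0 !polyC_natr; ring.
rewrite !coefB !coefZ !coefX !coefXn /=.
by congr WCurve; field.
Qed.

(* Main.v *)
Require Import Defs.
From mathcomp Require Import all_boot all_order all_algebra all_fingroup all_field.
From mathcomp Require Import zify ring lra.
From mathcomp Require Import all_classical all_reals all_analysis.
Set Implicit Arguments.
Unset Strict Implicit.
Unset Printing Implicit Defensive.
Import Order.TTheory GRing.Theory Num.Theory.
Local Open Scope ring_scope.

(** The Jacobian is [y^2 = x^3 - G^2 x] with [G = 4 Gamma], and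
    [G = +- gamma (2 k)^2] when [|Gamma| = gamma k^2] with [gamma] squarefree;
    so it is isomorphic to the congruent number curve
    [y^2 = x^3 - gamma^2 x].  Its minimal discriminant is [64 gamma^6], and its
    conductor is [32 gamma^2] or [16 gamma^2] according to the parity of
    [gamma]; both formulas are the quotient of the two logarithms.

    Minimality.  A change of variables of scale [u] divides the discriminant by
    [u^12] and [c4 = 48 gamma^2] by [u^4].  Squarefreeness leaves [u = 2] with
    [gamma] even as the only way to shrink an integral equation, and then [c4]
    would be [12] times an odd square, whereas an even [c4] of an integral
    equation is divisible by 16.  Two minimal equations thus differ by a change
    with [u = +- 1], whose other coefficients are integers, and the
    reduction modulo a prime dividing [2 gamma] has a cusp at the image of
    [(gamma, 0)].  The tame exponent is 2 everywhere.

    Wild part.  At odd primes it is computed on the 2-torsion, which is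
    rational, so it vanishes.  At 2 it is computed on the 3-torsion.  Let
    [(x1, y1)] be a 3-torsion point.  The field of 3-torsion is
    [Q(w, i, x1, y1)], [w] a cube root of unity, of degree 16, and it is a tower
    of three quadratic Eisenstein extensions of [Q(w)], in which 2 is inert:
<<
      l = 1 + i,     l^2 - 2 l = - 2,
      p,             p^2 + l p = l + 2 w,
      q,             q^2 + (2 - l) b q = N,
>>
    where [mu = l - 1 + l p] is the square root of [-3 + 2 i sqrt(-3)] inside
    [Q(w, x1)], and [q] is a normalisation of [theta - m], where [theta] is
    a multiple of [y1] whose square is [mu] or [- i mu] up to a factor
    [1 + 8 r].  In
    each step the valuation of the new generator is half of the preceding one,
    so [q], [p], [l], 2 have valuations 1, 2, 4, 8, and the valuation ring is
    generated by [l], [p], [q] over the integers of [Q(w)] at 2.  Hence an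
    element of inertia lies in the [i]-th ramification group as soon as it
    moves [l], [p] and [q] by at least [i + 1].

    Inertia is the group of order 8 fixing [w].  If [s] in it does not fix [l]
    and [p], then [s p - p] has valuation 4, hence [s N - N] too, and [s q - q]
    has valuation 2.  The one remaining nontrivial [s] moves [q] by
    [2 q + (2 - l) b], of valuation [k = 4] for odd and [k = 6] for even
    [gamma].  So the ramification groups have order 8 up to index 1, then 2 up
    to index [k - 1], then 1.  The involution sends every [y] to [- y], so each
    nontrivial group has no nonzero fixed 3-torsion point, and the wild part is
    [2 (1 + (k - 2) / 4)], that is 3 or 4. *)

(** * Valuations *)

Section Ultrametric.

Variables (L : fieldType) (p : nat) (v : L -> int).
Hypothesis hv : normalized_valuation p v.

(** [v 0] counts as [+oo]. *)
Definition vge (n : int) (x : L) : bool := (x == 0) || (n <= v x).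

Definition veq (n : int) (x : L) : bool := (x != 0) && (v x == n).

Lemma veq0 n x : veq n x -> x != 0.
Proof. by case/andP. Qed.

Lemma veqE n x : veq n x -> v x = n.
Proof. by case/andP => _ /eqP. Qed.

Lemma veq_val x : x != 0 -> veq (v x) x.
Proof. by move=> x0; rewrite /veq x0 eqxx. Qed.

Lemma veq_ge n x : veq n x -> vge n x.
Proof. by case/andP => _ /eqP h; rewrite /vge h lexx orbT. Qed.

Lemma vgeW m n x : m <= n -> vge n x -> vge m x.
Proof.
by move=> mn; rewrite /vge => /orP [->//|h]; rewrite (le_trans mn h) orbT.
Qed.

Lemma vge_veq n x : veq n x -> forall m, vge m x = (m <= n).
Proof. by case/andP=> /negPf x0 /eqP h m; rewrite /vge x0 h. Qed.

Lemma vge_0 n : vge n 0.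
Proof. by rewrite /vge eqxx. Qed.

Lemma veq_inj m n x : veq m x -> veq n x -> m = n.
Proof. by move=> /veqE <- /veqE. Qed.

Lemma veqM m n x y : veq m x -> veq n y -> veq (m + n) (x * y).
Proof.
case: hv => hM _ _ _ /andP [x0 /eqP hx] /andP [y0 /eqP hy].
by rewrite /veq mulf_neq0 //= hM // hx hy.
Qed.

Lemma vgeM m n x y : vge m x -> vge n y -> vge (m + n) (x * y).
Proof.
case: hv => hM _ _ _; rewrite /vge mulf_eq0.
case: (eqVneq x 0) => //= x0 hx; case: (eqVneq y 0) => //= y0 hy.
by rewrite hM // lerD.
Qed.

Lemma vgeD n x y : vge n x -> vge n y -> vge n (x + y).
Proof.
case: hv => _ hD _ _.
case: (eqVneq x 0) => [->|x0]; first by rewrite add0r.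
case: (eqVneq y 0) => [->|y0]; first by rewrite addr0.
rewrite /vge (negPf x0) (negPf y0) /=.
case: (eqVneq (x + y) 0) => //= xy0 hx hy.
by apply: le_trans (hD _ _ x0 y0 xy0); rewrite le_min hx hy.
Qed.

Lemma veq1 : veq 0 1.
Proof.
have /(veqM (veq_val (oner_neq0 L))) := veq_val (oner_neq0 L).
rewrite mulr1 => /veqE /eqP; rewrite -{1}[v 1]addr0 => /eqP/addrI h.
by rewrite /veq oner_neq0 -h eqxx.
Qed.

Lemma veqX n k x : veq n x -> veq (n *+ k) (x ^+ k).
Proof.
move=> hx; elim: k => [|k IH]; first by rewrite expr0 mulr0n veq1.
by rewrite exprS mulrS veqM.
Qed.

Lemma veq_sqr n x : veq (n + n) (x ^+ 2) -> veq n x.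
Proof.
move=> h; have x0 : x != 0 by move/veq0: h; rewrite sqrf_eq0.
have := veq_inj h (veqX 2 (veq_val x0)); rewrite /veq x0 mulr2n /=; lia.
Qed.

Lemma veqN1 : veq 0 (- 1).
Proof. by apply: veq_sqr; rewrite sqrrN expr1n veq1. Qed.

Lemma veqN n x : veq n (- x) = veq n x.
Proof.
suff h y : veq n y -> veq n (- y).
  by apply/idP/idP => [/h|/h//]; rewrite opprK.
by move=> hy; rewrite -mulN1r -[n]add0r veqM // veqN1.
Qed.

Lemma vgeN n x : vge n (- x) = vge n x.
Proof.
suff h y : vge n y -> vge n (- y).
  by apply/idP/idP => [/h|/h//]; rewrite opprK.
by move=> hy; rewrite -mulN1r -[n]add0r vgeM // veq_ge // veqN1.
Qed.

Lemma vgeB n x y : vge n x -> vge n y -> vge n (x - y).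
Proof. by move=> hx hy; rewrite vgeD // vgeN. Qed.

Lemma veqV n x : veq n x -> veq (- n) x^-1.
Proof.
move=> hx; have x0 := veq0 hx.
have := veqM hx (veq_val (invr_neq0 x0)); rewrite divff // => /veq_inj/(_ veq1).
rewrite /veq invr_neq0 //=; lia.
Qed.

(** Otherwise [x = (x + y) - y] would have valuation above [m]. *)
Lemma veqD m n x y : veq m x -> vge n y -> m < n -> veq m (x + y).
Proof.
move=> hx hy mn; have x0 := veq0 hx.
have hge : vge m (x + y) by rewrite vgeD ?(veq_ge hx) ?(vgeW (ltW mn)).
have xy0 : x + y != 0.
  apply: contraTneq mn => h; rewrite -leNgt -(vge_veq hx).
  by rewrite -[x](addrK y) h sub0r vgeN.
rewrite /veq xy0 eq_le; move: hge; rewrite {1}/vge (negPf xy0) /= => ->.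
rewrite andbT leNgt; apply/negP => lt.
have hxy := veq_ge (veq_val xy0); set m' := v (x + y) in lt hxy.
have : vge (Num.min n m') x.
  rewrite -[x](addrK y) vgeB //; first by apply: vgeW hxy; rewrite ge_min lexx orbT.
  by apply: vgeW hy; rewrite ge_min lexx.
rewrite (vge_veq hx); lia.
Qed.

Lemma veqDr m n x y : vge n x -> veq m y -> m < n -> veq m (x + y).
Proof. by move=> hx hy mn; rewrite addrC; apply: veqD mn. Qed.

Lemma vge_nat n : vge 0 n%:R.
Proof.
by elim: n => [|n IH]; rewrite ?vge_0 // mulrS vgeD // veq_ge // veq1.
Qed.

Lemma vge_int (z : int) : vge 0 z%:~R.
Proof. by case: z => n; rewrite ?NegzE ?mulrNz ?vgeN vge_nat. Qed.

Lemma vge1 : vge 0 1.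
Proof. exact: vge_nat 1%N. Qed.

Lemma vgeX k x : vge 0 x -> vge 0 (x ^+ k).
Proof.
move=> hx; elim: k => [|k IH]; first by rewrite expr0 vge1.
by rewrite exprS -[0]addr0 vgeM.
Qed.

Lemma vgeM0 x y : vge 0 x -> vge 0 y -> vge 0 (x * y).
Proof. by move=> hx hy; rewrite -[0]addr0 vgeM. Qed.

Lemma vgeMl n x y : vge n x -> vge 0 y -> vge n (x * y).
Proof. by move=> hx hy; rewrite -[n]addr0 vgeM. Qed.

Lemma vgeMr n x y : vge 0 x -> vge n y -> vge n (x * y).
Proof. by move=> hx hy; rewrite -[n]add0r vgeM. Qed.

(** The roots [a] and [- (a + b)] of [X^2 + b X - d] have the same valuation,
    since [v a >= n] would make [a (a + b)] of valuation at least [2 n].  Applied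
    to an Eisenstein equation this gives a uniformizer; applied to the equation
    of a difference of conjugates it gives a ramification number. *)
Lemma veq_quadratic m n a b d :
  a * (a + b) = d -> vge n b -> veq m d -> m < n + n ->
  exists2 k, veq k a & m = k + k.
Proof.
move=> e hb hd mn; have a0 : a != 0.
  by apply: contraTneq (veq0 hd) => a0; rewrite -e a0 mul0r eqxx.
have ha := veq_val a0; exists (v a) => //.
have lt : v a < n.
  rewrite ltNge; apply/negP => nva.
  have hna : vge n a := vgeW nva (veq_ge ha).
  have := vgeM hna (vgeD hna hb); rewrite e (vge_veq hd); lia.
by apply: (veq_inj hd); rewrite -e veqM // (veqD ha hb).
Qed.

Lemma val_geE n x : val_ge v n x = vge n%:Z x.
Proof. by []. Qed.

End Ultrametric.

(* Unfolding these during unification would compute in the abstract field. *)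
#[global] Opaque vge veq.

(** * Quadratic extensions generated by a uniformizer *)

Lemma two_mem (F : fieldType) (L : fieldExtType F) (K : {subfield L}) : 2 \in K.
Proof. by rewrite rpredMn // rpred1. Qed.

Section QuadraticStep.

Variables (F : fieldType) (L : fieldExtType F) (K : {subfield L}) (a b d : L).
Hypotheses (bK : b \in K) (dK : d \in K) (eqa : a * (a + b) = d).

Lemma adjoin_degree_quadratic : (adjoin_degree K a <= 2)%N.
Proof.
have pK : 'X * ('X + b%:P) - d%:P \is a polyOver K.
  by rewrite rpredB ?rpredM ?rpredD ?polyOverX ?polyOverC.
have sz : size ('X * ('X + b%:P) - d%:P) = 3%N.
  have s2 : size ('X * ('X + b%:P)) = 3%N by rewrite mulrC size_mulX ?size_XaddC // -size_poly_eq0 size_XaddC.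
  by rewrite size_polyDl // size_polyN s2 (leq_ltn_trans (size_polyC_leq1 _)).
have /(minPoly_dvdp pK) dv : root ('X * ('X + b%:P) - d%:P) a.
  by rewrite /root !hornerE eqa subrr.
have p0 : 'X * ('X + b%:P) - d%:P != 0 by rewrite -size_poly_eq0 sz.
by have := dvdp_leq p0 dv; rewrite sz size_minPoly ltnS.
Qed.

Lemma adjoin_quadraticP x : x \in <<K; a>>%VS ->
  exists x0 x1, [/\ x0 \in K, x1 \in K & x = x0 + x1 * a].
Proof.
move=> /Fadjoin_poly_eq e; set q := Fadjoin_poly K a x in e.
have qK : q \is a polyOver K := Fadjoin_polyOver K a x.
exists q`_0, q`_1; split; try exact: (polyOverP qK).
have sq : (size q <= 2)%N.
  exact: leq_trans (size_Fadjoin_poly _ _ _) adjoin_degree_quadratic.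
by rewrite -e (horner_coef_wide _ sq) !big_ord_recl big_ord0 /= expr0 expr1 mulr1 addr0.
Qed.

Lemma dim_adjoin_quadratic : a \notin K -> \dim <<K; a>> = (2 * \dim K)%N.
Proof.
move=> aK; rewrite dim_Fadjoin; congr (_ * _)%N.
apply/eqP; rewrite eqn_leq adjoin_degree_quadratic ltnNge.
apply: contra aK => le1; rewrite -adjoin_deg_eq1 eqn_leq le1.
by rewrite lt0n -(inj_eq succn_inj) /adjoin_degree.
Qed.

End QuadraticStep.

Section Tower.

Variables (F : fieldType) (L : fieldExtType F) (p : nat) (v : L -> int).
Hypothesis hv : normalized_valuation p v.

Definition values_in (K : {vspace L}) (D : int) : Prop :=
  forall x, x \in K -> x != 0 -> exists k : int, v x = D * k.

Variables (K : {subfield L}) (a b d : L) (D : int).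
Hypotheses (bK : b \in K) (dK : d \in K) (eqa : a * (a + b) = d).
Hypotheses (D0 : 0 < D) (hK : values_in K (D + D)) (ha : veq v D a).

(** The valuations of [K] are even multiples of [D]. *)
Lemma uniformizer_notin : a \notin K.
Proof.
apply/negP => aK; have [k] := hK aK (veq0 ha).
rewrite (veqE ha) => e.
have /eqP : D * (k + k - 1) = 0.
  by transitivity ((D + D) * k - D); [ring | rewrite -e subrr].
rewrite mulf_eq0; clear -D0; lia.
Qed.

(** The two terms have valuations of different parities as multiples of [D], so
    no cancellation is possible. *)
Lemma adjoin_valuation x0 x1 : x0 \in K -> x1 \in K -> x0 + x1 * a != 0 ->
  exists2 k : int, v (x0 + x1 * a) = D * k &
  forall n, vge v n (x0 + x1 * a) = vge v n x0 && vge v (n - D) x1.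
Proof.
move=> x0K x1K.
case: (eqVneq x1 0) => [->|nz1].
  rewrite mul0r addr0 => nz0; have [k hk] := hK x0K nz0.
  exists (k + k) => [|n]; first by rewrite hk; ring.
  by rewrite (vge_0 v (n - D)) andbT.
have [k1 hk1] := hK x1K nz1.
have h1 : veq v (D * (k1 + k1 + 1)) (x1 * a).
  have := veqM hv (veq_val v nz1) ha; rewrite hk1.
  by congr (veq _ _ _); ring.
have e1 n : vge v (n - D) x1 = (n <= D * (k1 + k1 + 1)).
  by rewrite (vge_veq (veq_val v nz1)) hk1 lerBlDr; congr (_ <= _); ring.
case: (eqVneq x0 0) => [->|nz0].
  rewrite add0r => nz; exists (k1 + k1 + 1) => [|n]; first exact: veqE h1.
  by rewrite (vge_0 v n) (vge_veq h1) e1.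
move=> nz; have [k0 hk0] := hK x0K nz0.
have h0 : veq v (D * (k0 + k0)) x0.
  by have := veq_val v nz0; rewrite hk0; congr (veq _ _ _); ring.
have [lt|lt] : (D * (k0 + k0) < D * (k1 + k1 + 1)) \/ (D * (k1 + k1 + 1) < D * (k0 + k0)).
  rewrite !(ltr_pM2l D0); clear; lia.
- have h := veqD hv h0 (veq_ge h1) lt; exists (k0 + k0) => [|n]; first exact: veqE h.
  by rewrite (vge_veq h) e1 (vge_veq h0) andb_idr // => /le_trans; apply; apply: ltW.
- have h := veqDr hv (veq_ge h0) h1 lt; exists (k1 + k1 + 1) => [|n]; first exact: veqE h.
  by rewrite (vge_veq h) e1 (vge_veq h0) andb_idl // => /le_trans; apply; apply: ltW.
Qed.

Lemma values_in_adjoin : values_in <<K; a>>%VS D.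
Proof.
move=> x /(adjoin_quadraticP bK dK eqa) [x0 [x1 [x0K x1K ->]]] nz.
by have [k hk _] := adjoin_valuation x0K x1K nz; exists k.
Qed.

(** [v x1 >= - D] and [2 D] divides [v x1]: a uniformizer generates the
    valuation ring over that of [K]. *)
Lemma integral_adjoin x : x \in <<K; a>>%VS -> vge v 0 x ->
  exists x0 x1, [/\ x0 \in K, x1 \in K, vge v 0 x0, vge v 0 x1 & x = x0 + x1 * a].
Proof.
case: (eqVneq x 0) => [-> _ _|].
  by exists 0, 0; rewrite !vge_0 !rpred0 mul0r addr0.
move=> nz /(adjoin_quadraticP bK dK eqa) [x0 [x1 [x0K x1K ex]]].
rewrite ex in nz *; have [_ _ ->] := adjoin_valuation x0K x1K nz.
case/andP => h0 h1; exists x0, x1; split=> //.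
case: (eqVneq x1 0) => [->|nz1]; first exact: vge_0.
have [k hk] := hK x1K nz1; move: h1.
rewrite !(vge_veq (veq_val v nz1)) hk sub0r => h.
have DD : 0 < D + D by rewrite addr_gt0.
rewrite pmulr_rge0 // leNgt; apply/negP => k0.
suff : (D + D) * k <= (D + D) * -1 by move: h DD; clear; lia.
by rewrite ler_pM2l //; lia.
Qed.

(** How far [s] moves integral elements is decided by how far it moves those of
    [K] and the generator. *)
Lemma adjoin_difference_bound (s : {rmorphism L -> L}) m :
  (forall x, x \in K -> vge v 0 x -> vge v m (s x - x)) ->
  vge v 0 (s a) -> vge v m (s a - a) ->
  forall x, x \in <<K; a>>%VS -> vge v 0 x -> vge v m (s x - x).
Proof.
move=> hs sa0 hsa x xKa xge.
have [x0 [x1 [x0K x1K h0 h1 ->]]] := integral_adjoin xKa xge.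
have -> : s (x0 + x1 * a) - (x0 + x1 * a) =
    (s x0 - x0) + ((s x1 - x1) * s a + x1 * (s a - a)).
  by rewrite rmorphD rmorphM; ring.
apply: (vgeD hv); first exact: hs.
by apply: (vgeD hv); [apply: (vgeMl hv) => //; apply: hs | apply: (vgeMr hv)].
Qed.

End Tower.

(** * The field of cube roots of unity, where 2 is inert *)

Section UnramifiedBase.

Variables (L : fieldExtType rat) (v : L -> int) (w : L).
Hypotheses (hv : normalized_valuation 2 v) (hw : w ^+ 2 = - w - 1).

Lemma ramification_index_gt0 : 0 < v 2.
Proof. by case: hv => _ _ _ []. Qed.

Lemma veq_two : veq v (v 2) 2.
Proof. by apply: veq_val; case: hv => _ _ _ []. Qed.

Lemma vge_even (z : int) : vge v (v 2) (2 * z%:~R).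
Proof. by rewrite (vgeMl hv) ?(vge_int hv) ?(veq_ge veq_two). Qed.

Lemma veq_odd (z : int) : odd `|z|%N -> veq v 0 (z%:~R : L).
Proof.
move=> oz; have -> : (z%:~R : L) = 1 + 2 * (((z - 1) %/ 2)%Z)%:~R.
  by rewrite -(intrM _ 2) -(intrD _ 1); congr (_%:~R); lia.
exact: (veqD hv (veq1 hv) (vge_even _) ramification_index_gt0).
Qed.

Lemma vge_cube_root : vge v 0 w.
Proof.
have e : w * (w + 1) = -1 by rewrite mulrDr mulr1 -expr2 hw; ring.
case: (boolP (vge v 0 w)) => // nw; have w0 : w != 0.
  by apply: contraNneq nw => ->; rewrite vge_0.
have hwv := veq_val v w0; rewrite (vge_veq hwv) -ltNge in nw.
have := veqM hv hwv (veqD hv hwv (vge1 hv) nw).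
by rewrite e => /(veq_inj (veqN1 hv)); lia.
Qed.

Lemma vge_cube_root_conj : vge v 0 (- 1 - w).
Proof. by rewrite (vgeB hv) ?vge_cube_root // (veq_ge (veqN1 hv)). Qed.

(** The norm [m^2 - m n + n^2] is odd unless [m] and [n] are both even. *)
Lemma veq_eisenstein (m n : int) : odd `|m|%N || odd `|n|%N ->
  veq v 0 (m%:~R + n%:~R * w).
Proof.
move=> o; set x := _ + _.
have hx : vge v 0 x.
  by rewrite (vgeD hv) ?(vgeM0 hv) ?(vge_int hv) ?vge_cube_root.
have hy : vge v 0 (m%:~R + n%:~R * (- 1 - w)).
  by rewrite (vgeD hv) ?(vgeM0 hv) ?(vge_int hv) ?vge_cube_root_conj.
have e : x * (m%:~R + n%:~R * (- 1 - w)) = (m ^+ 2 - m * n + n ^+ 2)%:~R.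
  by rewrite /x rmorphD rmorphB !rmorphM; ring: hw.
have hn : veq v 0 (x * (m%:~R + n%:~R * (- 1 - w))).
  by rewrite e veq_odd //; nia.
have x0 : x != 0 by apply: contraTneq (veq0 hn) => ->; rewrite mul0r eqxx.
have y0 := veq0 hn; rewrite mulf_eq0 negb_or in y0; case/andP: y0 => _ y0.
have := veq_inj hn (veqM hv (veq_val v x0) (veq_val v y0)).
move: hx hy; rewrite (vge_veq (veq_val v x0)) (vge_veq (veq_val v y0)) => vx vy vxy.
by have := veq_val v x0; congr (veq _ _ _); lia.
Qed.

Lemma values_eisenstein (m n : int) : (m != 0) || (n != 0) ->
  exists k : int, veq v (v 2 * k) (m%:~R + n%:~R * w).
Proof.
move: {2}(`|m| + `|n|)%N (leqnn (`|m| + `|n|)%N) => N.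
elim: N m n => [|N IH] m n le nz; first lia.
case: (boolP (odd `|m|%N || odd `|n|%N)) => [mn_odd|ev].
  by exists 0; rewrite mulr0 veq_eisenstein.
have [k hk] : exists k, veq v (v 2 * k) ((m %/ 2)%Z%:~R + (n %/ 2)%Z%:~R * w).
  by apply: IH; lia.
exists (k + 1); rewrite mulrDr mulr1 addrC.
have -> : m%:~R + n%:~R * w = 2 * ((m %/ 2)%Z%:~R + (n %/ 2)%Z%:~R * w).
  have -> : (m%:~R : L) = 2 * (m %/ 2)%Z%:~R.
    by rewrite -(intrM _ 2); congr (_%:~R); lia.
  have -> : (n%:~R : L) = 2 * (n %/ 2)%Z%:~R.
    by rewrite -(intrM _ 2); congr (_%:~R); lia.
  by ring.
by rewrite (veqM hv) // veq_two.
Qed.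

Lemma cube_root_quadratic : w * (w + 1) = - 1.
Proof. by rewrite mulrDr mulr1 -expr2 hw; ring. Qed.

(** After clearing denominators this is [values_eisenstein]: the extension is
    unramified, so its value group is that of the rationals. *)
Lemma values_base : values_in v <<1; w>>%VS (v 2).
Proof.
move=> x /(adjoin_quadraticP (rpred1 1%AS) _ cube_root_quadratic).
case; first by rewrite rpredN rpred1.
move=> _ [_ [/vlineP [r0 ->] /vlineP [r1 ->] ->]] nz.
pose m := numq r0 * denq r1; pose n := numq r1 * denq r0.
pose D := denq r0 * denq r1.
have rE (r : rat) : (r%:A : L) = (numq r)%:~R / (denq r)%:~R.
  by rewrite -{1}[r]divq_num_den -[LHS]/(in_alg L _) fmorph_div !rmorph_int.
have d0 (r : rat) : (denq r)%:~R != 0 :> L.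
  have := denq_neq0 r; rewrite -(intr_eq0 rat) -(fmorph_eq0 (in_alg L)).
  by rewrite rmorph_int.
have D0 : D%:~R != 0 :> L by rewrite /D intrM mulf_neq0.
have e : r0%:A + r1%:A * w = (m%:~R + n%:~R * w) / (D%:~R + 0%:~R * w).
  rewrite !rE /m /n /D !intrM mul0r addr0; field.
  by rewrite !d0.
have mn0 : (m != 0) || (n != 0).
  rewrite -negb_and; apply: contra nz => /andP [/eqP m0 /eqP n0].
  by rewrite e m0 n0 mul0r add0r mul0r.
have DD : (D != 0) || (0 != 0 :> int).
  by rewrite orbF mulf_neq0 ?denq_neq0.
have [k1 h1] := values_eisenstein mn0; have [k2 h2] := values_eisenstein DD.
exists (k1 - k2); rewrite e mulrBr.
exact: veqE (veqM hv h1 (veqV hv h2)).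
Qed.

Lemma cube_root_notin1 : w \notin 1%VS.
Proof.
apply/negP => /vlineP [r wE].
have : (r ^+ 2 + r + 1)%:A = 0 :> L.
  rewrite !scalerDl scale1r -[X in X + _ + _ = _]/(in_alg L _) rmorphXn /= -wE hw; ring.
move/eqP; rewrite -[X in X == _]/(in_alg L _) fmorph_eq0 => /eqP; nra.
Qed.

End UnramifiedBase.

(** * The ramification groups of the tower *)

Lemma galois_rat (L : splittingFieldType rat) (K : {subfield L}) : galois K {:L}.
Proof.
rewrite /galois subvf normalFieldf andbT /=.
by apply/separableP => y _; apply: pcharf0_separable => n; rewrite pchar_lalg pchar_num.
Qed.

Section QuaternionTower.

Variables (L : splittingFieldType rat) (v : L -> int) (w l p q b N eps nu : L).
Hypotheses (hv : normalized_valuation 2 v).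
Hypotheses (hw : w ^+ 2 = - w - 1) (hl : l ^+ 2 = 2 * l - 2).
Hypothesis hp : p ^+ 2 = l + 2 * w - l * p.

Local Notation K1 := <<1; w>>%AS.
Local Notation K2 := <<K1; l>>%AS.
Local Notation K3 := <<K2; p>>%AS.

Let l_quadratic : l * (l + - 2) = - 2.
Proof. by rewrite mulrDr -expr2 hl; ring. Qed.

Let p_quadratic : p * (p + l) = l + 2 * w.
Proof. by rewrite mulrDr -expr2 hp; ring. Qed.

(** Everything is a multiple of [v p] here; the valuation of [p] itself is known
    only once the last step is available, see [tower_values]. *)
Lemma middle_uniformizer :
  exists D : int, [/\ 0 < D, veq v D p, veq v (D + D) l & v 2 = (D + D) + (D + D)].
Proof.
move: (veq_two hv) (ramification_index_gt0 hv); move: (v 2) => E h2 E0.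
have h2N : veq v E (- 2) by rewrite (veqN hv).
have [|e he eE] := veq_quadratic hv l_quadratic (veq_ge h2N) h2N; first lia.
have hd : veq v e (l + 2 * w).
  apply: (veqD hv he) (_ : e < E); last by lia.
  by rewrite (vgeMl hv) ?(veq_ge h2) ?(vge_cube_root hv hw).
have [|D hD DE] := veq_quadratic hv p_quadratic (veq_ge he) hd; first lia.
by exists D; rewrite -DE -eE; split=> //; lia.
Qed.

Lemma vge_l : vge v 0 l.
Proof. by have [D [D0 _ h _]] := middle_uniformizer; apply: vgeW (veq_ge h); lia. Qed.

Lemma vge_p : vge v 0 p.
Proof. by have [D [D0 h _ _]] := middle_uniformizer; apply: vgeW (veq_ge h); lia. Qed.

(* The last step is Eisenstein because [eps] is a unit; its trace is divisible
   by [2 - l], the conjugate of [l]. *)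
Hypothesis hq : q * (q + (2 - l) * b) = N.
Hypotheses (hN : N = p * eps + l * nu) (genL : <<K3; q>>%VS = fullv).
Hypothesis mem3 : [/\ b \in K3, eps \in K3 & nu \in K3].
Hypotheses (hb : vge v 0 b) (heps : veq v 0 eps) (hnu : vge v 0 nu).

Lemma b_mem3 : b \in K3. Proof. by case: mem3. Qed.
Lemma eps_mem3 : eps \in K3. Proof. by case: mem3. Qed.
Lemma nu_mem3 : nu \in K3. Proof. by case: mem3. Qed.

Lemma w_mem1 : w \in K1. Proof. exact: memv_adjoin. Qed.
Lemma l_mem2 : l \in K2. Proof. exact: memv_adjoin. Qed.
Lemma w_mem2 : w \in K2. Proof. by rewrite subvP_adjoin // w_mem1. Qed.
Lemma p_mem3 : p \in K3. Proof. exact: memv_adjoin. Qed.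
Lemma l_mem3 : l \in K3. Proof. by rewrite subvP_adjoin // l_mem2. Qed.
Lemma w_mem3 : w \in K3. Proof. by rewrite subvP_adjoin // w_mem2. Qed.

Lemma trace3 : (2 - l) * b \in K3.
Proof. by rewrite rpredM ?b_mem3 // rpredB ?l_mem3 // two_mem. Qed.

Lemma norm3 : N \in K3.
Proof. by rewrite hN rpredD // rpredM ?p_mem3 ?l_mem3 ?eps_mem3 ?nu_mem3. Qed.

Lemma trace1 : - 2 \in K1. Proof. by rewrite rpredN two_mem. Qed.

Lemma norm2 : l + 2 * w \in K2.
Proof. by rewrite rpredD ?l_mem2 // rpredM ?w_mem2 // two_mem. Qed.

(** All valuations are multiples of [v q], and [v] takes the value 1. *)
Lemma tower_values : [/\ veq v 1 q, veq v 2 p, veq v 4 l & veq v 8 2].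
Proof.
have [D [D0 hDp hDl E]] := middle_uniformizer.
have h2 := veq_two hv; have v1 := values_base hv hw; rewrite {}E in h2 v1.
have h2l : vge v (D + D) (2 - l).
  by rewrite (vgeB hv) ?(veq_ge hDl) //; apply: vgeW (veq_ge h2); lia.
have hND : veq v D N.
  rewrite hN; apply: (veqD hv (n := D + D)); last lia.
  - by rewrite -[D]addr0 (veqM hv).
  - by rewrite (vgeMl hv) ?(veq_ge hDl).
have [|d hd dE] := veq_quadratic hv hq (vgeMl hv h2l hb) hND; first (clear -D0; lia).
have v2 := values_in_adjoin hv trace1 trace1 l_quadratic _ v1 hDl.
have v3 := values_in_adjoin hv l_mem2 norm2 p_quadratic D0 (v2 (addr_gt0 D0 D0)) hDp.
rewrite dE in v3; have d0 : 0 < d by clear -D0 dE; lia.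
have v4 := values_in_adjoin hv trace3 norm3 hq d0 v3 hd.
have d1 : d = 1.
  have [x x0 vx] : exists2 x : L, x != 0 & v x = 1 by case: hv.
  have [|k] := v4 x _ x0; first by rewrite genL memvf.
  rewrite vx => /(congr1 absz); rewrite abszM => /esym/eqP.
  by rewrite muln_eq1 => /andP [/eqP]; clear -d0; lia.
by move: hd hDp hDl h2; rewrite dE d1.
Qed.

Let hq1 : veq v 1 q. Proof. by case: tower_values. Qed.
Let hp2 : veq v 2 p. Proof. by case: tower_values. Qed.
Let hl4 : veq v 4 l. Proof. by case: tower_values. Qed.
Let h28 : veq v 8 2. Proof. by case: tower_values. Qed.

Lemma vge_2l : vge v 4 (2 - l).
Proof. by rewrite (vgeB hv) ?(veq_ge hl4) // (vgeW _ (veq_ge h28)). Qed.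

Lemma norm_value : veq v 2 N.
Proof.
rewrite hN; apply: (veqD hv (n := 4)) => //; first by rewrite -[2]addr0 (veqM hv).
by rewrite (vgeMl hv) ?(veq_ge hl4).
Qed.

Lemma values1 : values_in v K1 (4 + 4).
Proof. by have := values_base hv hw; rewrite (veqE h28). Qed.

Lemma values2 : values_in v K2 (2 + 2).
Proof. exact: (values_in_adjoin hv trace1 trace1 l_quadratic (ltr0Sn _ _) values1 hl4). Qed.

Lemma values3 : values_in v K3 (1 + 1).
Proof. exact: (values_in_adjoin hv l_mem2 norm2 p_quadratic (ltr0Sn _ _) values2 hp2). Qed.

(** The generator of a ramified step is not in the field below, so each step
    doubles the degree. *)
Lemma tower_dims : [/\ \dim K1 = 2, \dim K3 = 8 & \dim {:L} = 16]%N.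
Proof.
have d1 : \dim K1 = 2%N.
  rewrite (dim_adjoin_quadratic _ _ (cube_root_quadratic hw)) ?dimv1 ?rpred1 ?rpredN ?rpred1 //.
  exact: cube_root_notin1 hw.
have d2 : \dim K2 = 4%N.
  rewrite (dim_adjoin_quadratic trace1 trace1 l_quadratic) ?d1 //.
  exact: (uniformizer_notin (ltr0Sn _ _) values1 hl4).
have d3 : \dim K3 = 8%N.
  rewrite (dim_adjoin_quadratic l_mem2 norm2 p_quadratic) ?d2 //.
  exact: (uniformizer_notin (ltr0Sn _ _) values2 hp2).
split=> //; rewrite -genL (dim_adjoin_quadratic trace3 norm3 hq) ?d3 //.
exact: (uniformizer_notin ltr01 values3 hq1).
Qed.

Section Inertia.

Variable s : gal_of {:L}.
Hypothesis sw : s w = w.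

Lemma fix1 x : x \in K1 -> s x = x.
Proof.
case/(adjoin_quadraticP (rpred1 1%AS) _ (cube_root_quadratic hw)).
  by rewrite rpredN rpred1.
move=> _ [_ [/vlineP [r0 ->] /vlineP [r1 ->] ->]].
by rewrite rmorphD rmorphM /= !linearZ /= rmorph1 sw.
Qed.

Lemma conj_l : s l = l \/ s l = 2 - l.
Proof.
have /(congr1 s) := hl; rewrite rmorphXn rmorphB rmorphM rmorph_nat => e.
have /eqP : (s l - l) * (s l + l - 2) = 0.
  have -> : (s l - l) * (s l + l - 2) = s l ^+ 2 - 2 * s l - (l ^+ 2 - 2 * l) by ring.
  by rewrite e hl; ring.
rewrite mulf_eq0 => /orP [/eqP h|/eqP h]; [left|right].
- by apply/eqP; rewrite -subr_eq0 h.
- by apply/eqP; rewrite -subr_eq0 -[X in _ == X]h; apply/eqP; ring.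
Qed.

Lemma diff_l : vge v 8 (s l - l).
Proof.
case: conj_l => ->; first by rewrite subrr vge_0.
have -> : 2 - l - l = 2 * (1 - l) by ring.
by rewrite (vgeMl hv) ?(veq_ge h28) // (vgeB hv) ?(vge1 hv) // vge_l.
Qed.

Lemma vge_sl : vge v 4 (s l).
Proof.
rewrite -[s l](subrK l) (vgeD hv) ?(veq_ge hl4) //.
exact: vgeW _ diff_l.
Qed.

Lemma conj_p : s p * (s p + s l) = s l + 2 * w.
Proof. by have /(congr1 s) := p_quadratic; rewrite !(rmorphM, rmorphD) rmorph1 /= sw. Qed.

Lemma vge_2pl : vge v 4 (2 * p + l).
Proof.
rewrite (vgeD hv) ?(veq_ge hl4) // (vgeMl hv) ?vge_p //.
exact: vgeW _ (veq_ge h28).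
Qed.

Lemma vge_sp : vge v 0 (s p).
Proof.
have hd : veq v 4 (s l + 2 * w).
  rewrite -[s l](subrK l) addrAC; apply: (veqDr hv (n := 8)) => //.
  by rewrite (vgeD hv) ?diff_l // (vgeMl hv) ?(veq_ge h28) ?(vge_cube_root hv hw).
by have [//|k hk kE] := veq_quadratic hv conj_p vge_sl hd; apply: vgeW (veq_ge hk); clear -kE; lia.
Qed.

(** The difference [a] of the conjugates satisfies
    [a (a + 2 p + l) = (s l - l) (1 - s p)].  If [s l = l] then [a] is 0 or
    [- (2 p + l)]; otherwise the right-hand side has valuation 8, and
    [2 p + l] has valuation at least 4, which forces 4. *)
Lemma diff_p : (s l = l /\ s p = p) \/ veq v 4 (s p - p).
Proof.
set a := s p - p.
have ea : a * (a + (2 * p + l)) = (s l - l) * (1 - s p).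
  have -> : a * (a + (2 * p + l)) = s p * (s p + s l) - p * (p + l) - (s l - l) * s p.
    by rewrite /a; ring.
  by rewrite conj_p p_quadratic; ring.
case: conj_l => sl; last right.
  have : a * (a + (2 * p + l)) = 0 by rewrite ea sl subrr mul0r.
  move/eqP; rewrite mulf_eq0 => /orP [|] h; [left|right].
    by split=> //; apply/eqP; rewrite -subr_eq0.
  have -> : a = - (l + 2 * p).
    by apply/eqP; rewrite -subr_eq0; move: h; congr (_ == _); ring.
  rewrite (veqN hv); apply: (veqD hv (n := 8)) => //.
  by rewrite (vgeMl hv) ?vge_p ?(veq_ge h28).
have hsp : veq v 0 (1 - s p).
  have hd : veq v 4 (s l + 2 * w).
    rewrite -[s l](subrK l) addrAC; apply: (veqDr hv (n := 8)) => //.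
    by rewrite (vgeD hv) ?diff_l // (vgeMl hv) ?(veq_ge h28) ?(vge_cube_root hv hw).
  have [//|k hk kE] := veq_quadratic hv conj_p vge_sl hd.
  by apply: (veqD hv (n := k)) (veq1 hv) _ _; [rewrite (vgeN hv) (veq_ge hk) | clear -kE; lia].
have hd : veq v 8 (a * (a + (2 * p + l))).
  rewrite ea sl -[8]addr0 (veqM hv) //.
  have -> : 2 - l - l = 2 * (1 - l) by ring.
  rewrite -[8]addr0 (veqM hv) //; apply: (veqD hv (n := 4)) (veq1 hv) _ _ => //.
  by rewrite (vgeN hv) (veq_ge hl4).
have a0 : a != 0 by apply: contraTneq (veq0 hd) => ->; rewrite mul0r eqxx.
have ha := veq_val v a0; case: (ltgtP (v a) 4) => [lt|gt|eq].
- have := veqM hv ha (veqD hv ha vge_2pl lt) => /(veq_inj hd).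
  by move: (v a) lt; clear; lia.
- have h5 : vge v 5 a by apply: vgeW (veq_ge ha); move: (v a) gt; clear; lia.
  have := vgeM hv h5 (vgeD hv (vgeW _ h5) vge_2pl) => /(_ isT).
  by rewrite (vge_veq hd).
- by rewrite -eq.
Qed.

Lemma diff_p4 : vge v 4 (s p - p).
Proof. by case: diff_p => [[_ ->]|/veq_ge //]; rewrite subrr vge_0. Qed.

Lemma diff2 m x : vge v m (s l - l) -> x \in K2 -> vge v 0 x -> vge v m (s x - x).
Proof.
move=> hm; apply: (adjoin_difference_bound hv trace1 trace1 l_quadratic (ltr0Sn _ _) values1 hl4) => //.
- by move=> y yK _ /=; rewrite fix1 // subrr vge_0.
- exact: vgeW _ vge_sl.
Qed.

Lemma diff3 m x : vge v m (s l - l) -> vge v m (s p - p) ->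
  x \in K3 -> vge v 0 x -> vge v m (s x - x).
Proof.
move=> hm hm'; apply: (adjoin_difference_bound hv l_mem2 norm2 p_quadratic (ltr0Sn _ _) values2 hp2) => //.
- by move=> y /=; apply: diff2.
- exact: vge_sp.
Qed.

Lemma diff3_4 x : x \in K3 -> vge v 0 x -> vge v 4 (s x - x).
Proof. by apply: diff3 diff_p4; apply: vgeW _ diff_l. Qed.

Lemma fix3 x : s l = l -> s p = p -> x \in K3 -> s x = x.
Proof.
move=> sl sp; case/(adjoin_quadraticP l_mem2 norm2 p_quadratic) => x0 [x1 [h0 h1 ->]].
have fix2 y : y \in K2 -> s y = y.
  case/(adjoin_quadraticP trace1 trace1 l_quadratic) => y0 [y1 [g0 g1 ->]].
  by rewrite rmorphD rmorphM /= sl !fix1.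
by rewrite rmorphD rmorphM /= sp !fix2.
Qed.

Lemma conj_q : s q * (s q + s ((2 - l) * b)) = s N.
Proof. by have /(congr1 s) := hq; rewrite [s (q * _)]rmorphM /= [s (q + _)]rmorphD. Qed.

Let B := (2 - l) * b.
Let B4 : vge v 4 B. Proof. by rewrite (vgeMl hv) ?vge_2l. Qed.
Let dB4 : vge v 4 (s B - B). Proof. by apply: diff3_4 trace3 _; apply: vgeW B4. Qed.

Lemma value_sq : veq v 1 (s q).
Proof.
have hsN : veq v 2 (s N).
  rewrite -[s N](subrK N); apply: (veqDr hv _ norm_value (n := 4)) => //.
  by apply: diff3_4 norm3 _; apply: vgeW (veq_ge norm_value).
have hsB : vge v 4 (s B) by rewrite -[s B](subrK B) (vgeD hv).
have [//|k hk kE] := veq_quadratic hv conj_q hsB hsN.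
by move: hk; congr (veq _ _ _); clear -kE; lia.
Qed.

(** Same computation one step higher, where the difference [s N - N] is
    dominated by [(s p - p) s eps]. *)
Lemma diff_q_of_diff_p : veq v 4 (s p - p) -> veq v 2 (s q - q).
Proof.
move=> hsp; set a := s q - q.
have ea : a * (a + (2 * q + B)) = (s N - N) - (s B - B) * s q.
  have -> : a * (a + (2 * q + B)) = s q * (s q + s B) - q * (q + B) - (s B - B) * s q.
    by rewrite /a; ring.
  by rewrite conj_q hq.
have hbq : vge v 4 (2 * q + B).
  rewrite (vgeD hv) // (vgeMl hv) ?(vgeW _ (veq_ge h28)) //.
  exact: vgeW _ (veq_ge hq1).
have hdN : veq v 4 (s N - N).
  have -> : s N - N = (s p - p) * s eps + ((s eps - eps) * p + ((s l - l) * s nu + l * (s nu - nu))).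
    by rewrite hN rmorphD !rmorphM /=; ring.
  have hse : veq v 0 (s eps).
    rewrite -[s eps](subrK eps); apply: (veqDr hv _ heps (n := 4)) => //.
    exact: diff3_4 eps_mem3 (veq_ge heps).
  have hsnu : vge v 0 (s nu).
    by rewrite -[s nu](subrK nu) (vgeD hv) //; apply: vgeW (diff3_4 nu_mem3 hnu).
  apply: (veqD hv (n := 6)) => //; first by rewrite -[4]addr0 (veqM hv).
  apply: (vgeD hv).
    by have := vgeM hv (diff3_4 eps_mem3 (veq_ge heps)) (veq_ge hp2).
  apply: (vgeD hv); first by rewrite (vgeMl hv) ?(vgeW _ diff_l).
  by apply: vgeW (vgeM hv (veq_ge hl4) (diff3_4 nu_mem3 hnu)).
have hd : veq v 4 (s N - N - (s B - B) * s q).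
  apply: (veqD hv (n := 5)) hdN _ _ => //.
  by rewrite (vgeN hv); have := vgeM hv dB4 (veq_ge value_sq).
have [//|k hk kE] := veq_quadratic hv ea hbq hd.
by move: hk; congr (veq _ _ _); clear -kE; lia.
Qed.

Lemma conj_q_fix3 : s l = l -> s p = p -> s q = q \/ s q = - q - B.
Proof.
move=> sl sp; have := conj_q; rewrite (fix3 sl sp norm3) (fix3 sl sp trace3) => e.
have /eqP : (s q - q) * (s q + q + B) = 0.
  have -> : (s q - q) * (s q + q + B) = s q * (s q + B) - q * (q + B) by ring.
  by rewrite e hq subrr.
rewrite mulf_eq0 => /orP [/eqP h|/eqP h]; [left|right].
- by apply/eqP; rewrite -subr_eq0 h.
- by apply/eqP; rewrite -subr_eq0 -[X in _ == X]h; apply/eqP; ring.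
Qed.

Lemma diffL m : vge v m (s l - l) -> vge v m (s p - p) -> vge v m (s q - q) ->
  forall x, vge v 0 x -> vge v m (s x - x).
Proof.
move=> h1 h2 h3 x; have : x \in <<K3; q>>%VS by rewrite genL memvf.
apply: (adjoin_difference_bound hv trace3 norm3 hq ltr01 values3 hq1) => //.
- by move=> y /=; apply: diff3.
- exact: vgeW _ (veq_ge value_sq).
Qed.

End Inertia.

Variable k : nat.
Hypotheses (k4 : (4 <= k < 9)%N) (hk : veq v k ((2 - l) * b)).

Lemma ramificationP (s : gal_of {:L}) i :
  reflect (forall x, vge v 0 x -> vge v i.+1 (s x - x))
          (s \in ramification_group v i).
Proof.
rewrite inE (gal_kHom _ (sub1v _)) k1AHom /=.
by apply: (iffP (asboolP _)) => h x; move: (h x); rewrite !(val_geE v).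
Qed.

(** The two cube roots of unity differ by a unit. *)
Lemma ramification_group_sub (s : gal_of {:L}) i :
  s \in ramification_group v i -> s w = w.
Proof.
move=> /ramificationP /(_ w (vge_cube_root hv hw)) h.
have /(congr1 s) := hw; rewrite rmorphXn rmorphB rmorphN rmorph1 /= => e.
have /eqP : (s w - w) * (s w + w + 1) = 0.
  have -> : (s w - w) * (s w + w + 1) = (s w ^+ 2 + s w) - (w ^+ 2 + w) by ring.
  by rewrite e hw; ring.
rewrite mulf_eq0 => /orP [/eqP h0|/eqP h0].
  by apply/eqP; rewrite -subr_eq0 h0.
have swE : s w - w = 2 * (- w) - 1.
  by rewrite -[s w](addrK (w + 1)) addrA h0; ring.
have h1 : veq v 0 (s w - w).
  rewrite swE; apply: (veqDr hv _ (veqN1 hv) (n := 8)) => //.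
  by rewrite (vgeMl hv) ?(veq_ge h28) // (vgeN hv) (vge_cube_root hv hw).
by move: h; rewrite (vge_veq h1).
Qed.

Lemma memGal1 (s : gal_of {:L}) : (s \in 'Gal({:L} / K1)%g) = (s w == w).
Proof.
apply/idP/eqP => [h|sw]; first exact: fixed_gal (subvf _) h w_mem1.
rewrite (gal_kHom _ (subvf _)); apply/kAHomP => x xK; exact: fix1.
Qed.

Lemma memGal3 (s : gal_of {:L}) :
  (s \in 'Gal({:L} / K3)%g) = [&& s w == w, s l == l & s p == p].
Proof.
apply/idP/and3P => [h|[/eqP sw /eqP sl /eqP sp]].
  by split; apply/eqP; apply: fixed_gal (subvf _) h _; rewrite ?w_mem3 ?l_mem3 ?p_mem3.
rewrite (gal_kHom _ (subvf _)); apply/kAHomP => x xK; exact: fix3.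
Qed.

(** Inertia is wild: a nontrivial element fixing [w] moves [q] by 2 or by more. *)
Lemma ramification_low i : (i < 2)%N -> ramification_group v i = 'Gal({:L} / K1)%g.
Proof.
move=> i2; apply/setP => s; rewrite memGal1.
apply/idP/eqP => [/ramification_group_sub //|sw]; apply/ramificationP.
move=> x x0; apply: (@vgeW _ v i.+1 2); first by clear -i2; lia.
have h1 : vge v 2 (s l - l) by apply: vgeW (diff_l s).
have h2 : vge v 2 (s p - p) by apply: vgeW (diff_p4 sw).
apply: (diffL sw h1 h2 _ x0).
case: (diff_p sw) => [[sl sp]|]; last by move/(diff_q_of_diff_p sw)/veq_ge.
case: (conj_q_fix3 sw sl sp) => ->; first by rewrite subrr vge_0.
have -> : - q - (2 - l) * b - q = - (2 * q + (2 - l) * b) by ring.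
rewrite (vgeN hv) (vgeD hv) //.
  by apply: vgeW (vgeM hv (veq_ge h28) (veq_ge hq1)).
by apply: vgeW (vgeM hv vge_2l hb).
Qed.

Lemma gal_eq1 (s : gal_of {:L}) : s w = w -> s l = l -> s p = p -> s q = q ->
  s = 1%g.
Proof.
move=> sw sl sp sq; apply/eqP/gal_eqP => x _; rewrite gal_id.
have : x \in <<K3; q>>%VS by rewrite genL memvf.
case/(adjoin_quadraticP trace3 norm3 hq) => x0 [x1 [h0 h1 ->]].
by rewrite rmorphD rmorphM /= sq (fix3 sw sl sp h0) (fix3 sw sl sp h1).
Qed.

Lemma diff_q_last (s : gal_of {:L}) : s w = w -> s l = l -> s p = p -> s != 1%g ->
  veq v k (s q - q).
Proof.
move=> sw sl sp s1; case: (conj_q_fix3 sw sl sp) => [sq|->].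
  by rewrite (gal_eq1 sw sl sp sq) eqxx in s1.
have -> : - q - (2 - l) * b - q = - (2 * q + (2 - l) * b) by ring.
rewrite (veqN hv); apply: (veqDr hv (veq_ge (veqM hv h28 hq1)) hk).
by clear -k4; lia.
Qed.

Lemma ramification_middle i : (2 <= i < k)%N -> ramification_group v i = 'Gal({:L} / K3)%g.
Proof.
move=> i2; apply/setP => s; rewrite memGal3.
have i2' : (2 <= i)%N by case/andP: i2.
apply/idP/and3P => [h|[/eqP sw /eqP sl /eqP sp]].
  have sw := ramification_group_sub h; move/ramificationP: h => h.
  have := diff_p sw; case=> [[-> ->]|/(diff_q_of_diff_p sw) h2]; first by rewrite sw !eqxx.
  have := h q (vgeW _ (veq_ge hq1)) => /(_ isT); rewrite (vge_veq h2).
  by clear -i2'; lia.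
apply/ramificationP => x x0; apply: (@vgeW _ v i.+1 k); first by clear -i2; lia.
apply: (@diffL s sw k) x0; rewrite ?sl ?sp ?subrr ?vge_0 //.
case: (eqVneq s 1%g) => [->|s1]; first by rewrite gal_id subrr vge_0.
exact: veq_ge (diff_q_last sw sl sp s1).
Qed.

Lemma ramification_high i : (k <= i)%N -> ramification_group v i = [set 1%g].
Proof.
move=> ki; apply/setP => s; rewrite finset.in_set1.
apply/idP/eqP => [h|->]; last first.
  by apply/ramificationP => x _; rewrite gal_id subrr vge_0.
have sw := ramification_group_sub h; move/ramificationP: h => h.
have i2' : (4 <= i)%N by clear -ki k4; lia.
have := h q (vgeW _ (veq_ge hq1)) => /(_ isT) {}h.
case: (diff_p sw) => [[sl sp]|/(diff_q_of_diff_p sw) h2]; last first.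
  by move: h; rewrite (vge_veq h2); clear -i2'; lia.
apply/eqP/negPn/negP => /(diff_q_last sw sl sp) h2.
by move: h; rewrite (vge_veq h2); clear -ki; lia.
Qed.

Lemma card_gal1 : #|'Gal({:L} / K1)%g| = 8%N.
Proof.
have [d1 _ d16] := tower_dims.
rewrite -galois_dim ?d1 ?d16 //; exact: galois_rat.
Qed.

Lemma card_gal3 : #|'Gal({:L} / K3)%g| = 2%N.
Proof.
have [_ d8 d16] := tower_dims.
rewrite -galois_dim ?d8 ?d16 //; exact: galois_rat.
Qed.

(** The nontrivial element of the last ramification group. *)
Lemma exists_central_involution :
  exists h : gal_of {:L}, [/\ h w = w, h l = l, h p = p & h != 1%g].
Proof.
have : (1 < #|'Gal({:L} / K3)%g|)%N by rewrite card_gal3.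
rewrite cardG_gt1 => /trivgPn [h]; rewrite memGal3.
by case/and3P => /eqP ? /eqP ? /eqP ? ?; exists h.
Qed.

(** Only the first term has a group of order 8, and [k - 2] terms have a group
    of order 2; [f i] stands for the dimension of the space of fixed points. *)
Lemma swan_conductor (f : nat -> nat) n :
  ramification_group v n = [set 1%g] ->
  (forall i, (0 < i < k)%N -> f i = 0%N) -> (forall i, (k <= i)%N -> f i = 2%N) ->
  \sum_(1 <= i < n)
     #|ramification_group v i|%:R / #|ramification_group v 0|%:R * (2 - f i)%:R
  = 2 + (k - 2)%:R / 2 :> rat.
Proof.
move=> hn f0 f2; have c1 := card_gal1; have c3 := card_gal3.
have kn : (k <= n)%N.
  rewrite leqNgt; apply/negP => nk; have : #|ramification_group v n| = 1%N by rewrite hn cards1.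
  case: (ltnP n 2) => n2; first by rewrite ramification_low // c1.
  by rewrite ramification_middle ?c3 // n2.
have k2 : (2 <= k)%N by clear -k4; lia.
rewrite (big_cat_nat _ kn) /=; last by rewrite ltnW.
rewrite [X in _ + X]big_nat_cond [X in _ + X]big1 ?addr0; last first.
  by move=> i; rewrite andbT => /andP [ki _]; rewrite f2 // mulr0.
rewrite big_ltn // f0 ?k2 // !ramification_low // c1.
congr (_ + _).
rewrite (eq_big_nat _ _ (F2 := fun=> 1 / 2)).
  by rewrite sumr_const_nat mul1r -[LHS]mulr_natl.
move=> i i2; rewrite ramification_middle // c3 f0 //.
by case/andP: i2 => i2 ->; rewrite (ltnW i2).
Qed.

Variables (T : seq (wpoint L)) (y1 : L).
Hypotheses (uT : uniq T) (sT : size T = 9%N) (hq_y1 : q \in <<K3; y1>>%VS).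
Hypothesis T_y1 : forall x y, Some (x, y) \in T ->
  exists2 c, c \in K3 & y = c * y1 /\ c != 0.

Lemma involution_moves (h : gal_of {:L}) : h w = w -> h l = l -> h p = p ->
  h != 1%g -> h y1 != y1.
Proof.
move=> hw' hl' hp'; apply: contra => /eqP hy1.
have sub : (<<K3; y1>> <= fixedField [set h])%VS.
  apply/FadjoinP; split.
    by apply/subvP => x xK; apply/fixedFieldP; rewrite ?memvf // => s /set1P ->; exact: fix3.
  by apply/fixedFieldP; rewrite ?memvf // => s /set1P ->.
have hq' : h q = q.
  have /fixedFieldP := subvP sub _ hq_y1; rewrite memvf => /(_ isT); apply.
  by rewrite finset.set11.
by rewrite (gal_eq1 hw' hl' hp' hq').
Qed.

(** Every nontrivial ramification group contains the involution, which moves all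
    the ordinates as it fixes the multipliers [c] and moves [y1]. *)
Lemma fixed_points_nontrivial i : (0 < i < k)%N ->
  logn 3 (size (fixed_points T (ramification_group v i))) = 0%N.
Proof.
move=> ik; have [h [hw' hl' hp' h1]] := exists_central_involution.
have hG : h \in ramification_group v i.
  case: (ltnP i 2) => i2; first by rewrite ramification_low // memGal1 hw'.
  by rewrite ramification_middle ?memGal3 ?hw' ?hl' ?hp' ?eqxx // i2; case/andP: ik.
have hy := involution_moves hw' hl' hp' h1.
suff : (size (fixed_points T (ramification_group v i)) <= 1)%N.
  by case: (size _) => [|[|]].
apply: (@uniq_leq_size _ _ [:: None]); first exact: filter_uniq.
move=> [[x y]|]; rewrite mem_filter // => /andP [/forall_inP /(_ h hG) /= /eqP [_ hy'] /T_y1].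
case=> c cK [yE c0]; case/eqP: hy; move: hy'; rewrite yE rmorphM /= (fix3 hw' hl' hp' cK).
exact: mulfI.
Qed.

Lemma fixed_points_trivial i : (k <= i)%N ->
  logn 3 (size (fixed_points T (ramification_group v i))) = 2%N.
Proof.
move=> ki; rewrite ramification_high //.
rewrite /fixed_points (eq_filter (a2 := xpredT)) ?filter_predT ?sT // => P.
apply/forall_inP => s /set1P ->; case: P => [[x y]|] //=.
by rewrite !gal_id.
Qed.

Lemma wild_sum n : ramification_group v n = [set 1%g] ->
  \sum_(1 <= i < n) #|ramification_group v i|%:R / #|ramification_group v 0|%:R
     * (2 - logn 3 (size (fixed_points T (ramification_group v i))))%:R
  = 2 + (k - 2)%:R / 2 :> rat.
Proof.
move=> hn; apply: swan_conductor hn _ _.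
- exact: fixed_points_nontrivial.
- exact: fixed_points_trivial.
Qed.

End QuaternionTower.

(** * The 3-torsion of [y^2 = x^3 - g^2 x] *)

Section CongruentCurveTorsion.

Variables (F : fieldType) (A : F).
Hypothesis two0 : 2 != 0 :> F.

Local Notation E := (WCurve 0 0 0 (- A) 0).

Lemma on_congruentE x y :
  on_wcurve E (Some (x, y)) = (y ^+ 2 == x ^+ 3 - A * x).
Proof. by rewrite /on_wcurve !mul0r !addr0 mulNr. Qed.

Lemma two_torsionP x y : wmuln E 2 (Some (x, y)) = None -> y = 0.
Proof.
rewrite /wmuln /= eqxx mul0r !addr0 /=; case: eqP => // /eqP.
by rewrite -mulr2n -mulr_natl mulf_eq0 (negPf two0) => /eqP.
Qed.

(** [3 P = 0] says that [P] and [2 P] have the same abscissa. *)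
Lemma three_torsionP x y : on_wcurve E (Some (x, y)) ->
  wmuln E 3 (Some (x, y)) = None -> 3 * x ^+ 4 - 6 * A * x ^+ 2 - A ^+ 2 = 0.
Proof.
rewrite on_congruentE => /eqP hy.
rewrite /wmuln /= eqxx mul0r !addr0 /=; case: (eqVneq (y + y) 0) => //= yy0.
rewrite !mulr0 !mul0r !addr0 !subr0; case: eqVneq => //= xE _.
have y0 : y != 0 by apply: contraNneq yy0 => ->; rewrite addr0.
have e : 3 * x * (4 * y ^+ 2) = (3 * x ^+ 2 - A) ^+ 2.
  have -> : 3 * x = ((3 * x ^+ 2 - A) / (2 * y)) ^+ 2 by transitivity (x + x + x); [ring | rewrite {3}xE; field; rewrite y0 two0].
  by field; rewrite y0 two0.
have -> : 3 * x ^+ 4 - 6 * A * x ^+ 2 - A ^+ 2 =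
    3 * x * (4 * (x ^+ 3 - A * x)) - (3 * x ^+ 2 - A) ^+ 2 by ring.
by rewrite -hy e subrr.
Qed.

End CongruentCurveTorsion.

Lemma natr_neq0 (L : fieldExtType rat) n : n.+1%:R != 0 :> L.
Proof. by rewrite -(rmorph_nat (in_alg L)) fmorph_eq0 pnatr_eq0. Qed.

Lemma one_plus_i_neq0 (L : fieldExtType rat) (l : L) : l ^+ 2 = 2 * l - 2 -> l != 0.
Proof.
move=> hl; apply/eqP => h; move: hl; rewrite h expr0n mulr0 sub0r => /eqP.
by rewrite eq_sym oppr_eq0 (negPf (natr_neq0 L 1)).
Qed.

Section ThreeTorsionField.

(* [x1] and [x2] are abscissas of 3-torsion points of [y^2 = x^3 - g^2 x]
   with different squares, and [y1] is an ordinate above [x1]. *)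
Variables (L : fieldExtType rat) (g x1 y1 x2 : L).
Hypotheses (g0 : g != 0) (hx1 : 3 * x1 ^+ 4 - 6 * g ^+ 2 * x1 ^+ 2 - (g ^+ 2) ^+ 2 = 0).
Hypotheses (hx2 : 3 * x2 ^+ 4 - 6 * g ^+ 2 * x2 ^+ 2 - (g ^+ 2) ^+ 2 = 0).
Hypotheses (x12 : x1 ^+ 2 != x2 ^+ 2) (hy1 : y1 ^+ 2 = x1 ^+ 3 - g ^+ 2 * x1).

Let n2 : 2 != 0 :> L := natr_neq0 L 1.
Let n3 : 3 != 0 :> L := natr_neq0 L 2.
Let n4 : 4 != 0 :> L := natr_neq0 L 3.

(** By [quartic_prod] the product [x1 x2] is [g^2] divided by a square root of
    -3. *)
Definition root_m3 : L := g ^+ 2 / (x1 * x2).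
(** [(x1^2 / g^2 - 1)^2 = 4 / 3] gives a square root of 3, hence one of -1. *)
Definition root_m1 : L := root_m3 * (x1 ^+ 2 / g ^+ 2 - 1) / 2.
Local Notation sq := root_m3.
Local Notation ii := root_m1.

Lemma quartic_sum : x1 ^+ 2 + x2 ^+ 2 = 2 * g ^+ 2.
Proof.
have /eqP : 3 * (x1 ^+ 2 - x2 ^+ 2) * (x1 ^+ 2 + x2 ^+ 2 - 2 * g ^+ 2) = 0.
  by rewrite -[RHS](subrr 0) -{1}hx1 -hx2; ring.
by rewrite !mulf_eq0 (negPf n3) subr_eq0 (negPf x12) subr_eq0 => /eqP.
Qed.

Lemma quartic_prod : 3 * (x1 ^+ 2 * x2 ^+ 2) = - (g ^+ 2) ^+ 2.
Proof.
have e : x2 ^+ 2 = 2 * g ^+ 2 - x1 ^+ 2 by rewrite -quartic_sum; ring.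
by apply/eqP; rewrite -subr_eq0 -[X in _ == X]oppr0 -hx1 e; apply/eqP; ring.
Qed.

Lemma x1x2_neq0 : x1 * x2 != 0.
Proof.
apply/eqP => h; move: quartic_prod; rewrite -exprMn h expr0n mulr0 => /eqP.
by rewrite eq_sym oppr_eq0 !expf_eq0 (negPf g0).
Qed.

Lemma x1_neq0 : x1 != 0.
Proof. by have := x1x2_neq0; rewrite mulf_eq0 negb_or => /andP []. Qed.

Lemma x2_neq0 : x2 != 0.
Proof. by have := x1x2_neq0; rewrite mulf_eq0 negb_or => /andP []. Qed.

Lemma root_m3E : sq ^+ 2 = - 3.
Proof.
apply/eqP; rewrite -subr_eq0.
have -> : sq ^+ 2 - - 3 = (3 * (x1 ^+ 2 * x2 ^+ 2) + (g ^+ 2) ^+ 2) / (x1 * x2) ^+ 2.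
  by rewrite /root_m3; field; rewrite x1_neq0 x2_neq0.
by rewrite quartic_prod addNr mul0r.
Qed.

Lemma root_m1_rel : x1 ^+ 2 = g ^+ 2 * (1 - 2 * sq * ii / 3).
Proof.
have e : 2 * sq * ii = sq ^+ 2 * (x1 ^+ 2 / g ^+ 2 - 1) by rewrite /root_m1; field; rewrite ?g0 ?n2 ?n4.
by rewrite e root_m3E; field; rewrite g0 n3.
Qed.

Lemma root_m1E : ii ^+ 2 = - 1.
Proof.
have -> : ii ^+ 2 = sq ^+ 2 * (x1 ^+ 2 / g ^+ 2 - 1) ^+ 2 / 4 by rewrite /root_m1; field; rewrite ?g0 ?n2 ?n4.
rewrite root_m3E; apply/eqP; rewrite -subr_eq0.
have -> : -3 * (x1 ^+ 2 / g ^+ 2 - 1) ^+ 2 / 4 - -1 =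
    - (3 * x1 ^+ 4 - 6 * g ^+ 2 * x1 ^+ 2 - (g ^+ 2) ^+ 2) / (4 * g ^+ 4).
  by field; rewrite g0 n4.
by rewrite hx1 oppr0 mul0r.
Qed.

Definition tower_w : L := (sq - 1) / 2.
Definition tower_l : L := 1 + ii.
(** [g / x2] is the square root [mu] of [-3 + 2 i sqrt(-3)], which is close to
    [i] at 2. *)
Definition tower_p : L := (g / x2 - ii) / tower_l.
Local Notation w := tower_w.
Local Notation l := tower_l.
Local Notation p := tower_p.

Lemma sqE : sq = 1 + 2 * w.
Proof. by rewrite /tower_w; field; rewrite n2. Qed.

Lemma iiE : ii = l - 1.
Proof. by rewrite /tower_l; ring. Qed.

Lemma tower_wE : w ^+ 2 = - w - 1.
Proof.
apply: (mulfI (natr_neq0 L 3)); transitivity ((1 + 2 * w) ^+ 2 - 1 - 4 * w); first by ring.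
by rewrite -sqE root_m3E; ring.
Qed.

Lemma tower_lE : l ^+ 2 = 2 * l - 2.
Proof.
have := root_m1E; rewrite iiE => e.
transitivity ((l - 1) ^+ 2 - 1 + 2 * l); first by ring.
by rewrite e; ring.
Qed.

Lemma l_neq0 : l != 0.
Proof. exact: one_plus_i_neq0 tower_lE. Qed.

Lemma muE : g / x2 = l - 1 + l * p.
Proof. by rewrite -iiE /tower_p; field; rewrite x2_neq0 l_neq0. Qed.

Lemma mu_sqr : (l - 1 + l * p) ^+ 2 = - 3 + 2 * (l - 1) * (1 + 2 * w).
Proof.
rewrite -muE -iiE -sqE.
have h : (g / x2) ^+ 2 = - 3 * x1 ^+ 2 / g ^+ 2.
  have -> : (g / x2) ^+ 2 = - 3 * x1 ^+ 2 / g ^+ 2 +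
     (3 * (x1 ^+ 2 * x2 ^+ 2) + (g ^+ 2) ^+ 2) / (x2 ^+ 2 * g ^+ 2).
    by field; rewrite g0 x2_neq0.
  by rewrite quartic_prod addNr mul0r addr0.
by rewrite h root_m1_rel; field; rewrite n3 g0.
Qed.

Lemma tower_pE : p ^+ 2 = l + 2 * w - l * p.
Proof.
have l2 : l ^+ 2 != 0 by rewrite expf_neq0 // l_neq0.
apply: (mulfI l2); apply/eqP; rewrite -subr_eq0.
have -> : l ^+ 2 * p ^+ 2 - l ^+ 2 * (l + 2 * w - l * p) =
  (l - 1 + l * p) ^+ 2 - (- 3 + 2 * (l - 1) * (1 + 2 * w)).
  by ring: tower_lE.
by rewrite mu_sqr subrr.
Qed.

Local Notation mu := (l - 1 + l * p).

Lemma sq_neq0 : sq != 0.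
Proof. by rewrite mulf_neq0 ?invr_eq0 ?x1x2_neq0 // expf_neq0. Qed.

Lemma x1E : x1 = g * mu / (1 + 2 * w).
Proof. by rewrite -muE -sqE /root_m3; field; rewrite g0 x2_neq0 x1_neq0. Qed.

Lemma y1_sqr : (y1 * (1 + 2 * w)) ^+ 2 = g ^+ 3 * l ^+ 2 * mu.
Proof.
rewrite exprMn hy1 -sqE.
have -> : x1 ^+ 3 - g ^+ 2 * x1 = x1 * (x1 ^+ 2 - g ^+ 2) by ring.
have -> : x1 ^+ 2 - g ^+ 2 = g ^+ 2 * 2 * ii / sq.
  rewrite /root_m1; field.
  by rewrite sq_neq0 g0 n2.
rewrite {1}x1E iiE -sqE; apply/eqP; rewrite -subr_eq0.
have -> : g * mu / sq * (g ^+ 2 * 2 * (l - 1) / sq) * sq ^+ 2 - g ^+ 3 * l ^+ 2 * mu =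
  g ^+ 3 * mu * (2 * l - 2 - l ^+ 2) by field; rewrite sq_neq0.
by rewrite tower_lE subrr mulr0.
Qed.

Lemma sq_ii : (sq + 2 * ii) * (sq - 2 * ii) = 1.
Proof.
transitivity (sq ^+ 2 - 4 * ii ^+ 2); first by ring.
by rewrite root_m3E root_m1E; ring.
Qed.

(** [sq + 2 i] is [x1 / x2], and its inverse is [sq - 2 i] by [sq_ii]. *)
Lemma x2_x1 : x2 = x1 * (sq - 2 * ii).
Proof.
have e : x1 = x2 * (sq + 2 * ii).
  have -> : sq + 2 * ii = sq * (1 - 2 * sq * ii / 3) + 2 * ii / 3 * (sq ^+ 2 + 3).
    by field; rewrite n3.
  rewrite root_m3E addNr mulr0 addr0.
  have sq12 : x2 * sq * x1 = g ^+ 2 by rewrite /root_m3; field; rewrite x1_neq0 x2_neq0.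
  by apply: (mulIf x1_neq0); rewrite -expr2 root_m1_rel -{1}sq12; ring.
by rewrite [X in _ = X * _]e -mulrA sq_ii mulr1.
Qed.

(* Here [i (x, y) = (- x, i y)], and [x2] is the abscissa of [P + i P] for
   [P = (x1, y1)].  The chord formula gives its ordinate as [- m0 y1]. *)
Let m0 : L := ((1 + ii) + (1 - ii) * (sq - 2 * ii)) / 2.

Lemma m0_sqr : m0 ^+ 2 = 2 * ii - sq.
Proof.
have e1 := root_m3E; have e2 := root_m1E.
transitivity (((1 + ii) + (1 - ii) * (sq - 2 * ii)) ^+ 2 / 4).
  by rewrite /m0; field; rewrite n2 n4.
have -> : ((1 + ii) + (1 - ii) * (sq - 2 * ii)) ^+ 2 = 4 * (2 * ii - sq) by ring: e1 e2.
by field; rewrite n4.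
Qed.

(** Every abscissa is [+- x1] or [+- x2], and complex multiplication by [i]
    exchanges the two signs. *)
Lemma torsion_coordinates (K : {subfield L}) x y :
  g \in K -> ii \in K -> sq \in K -> g / x2 \in K ->
  3 * x ^+ 4 - 6 * g ^+ 2 * x ^+ 2 - (g ^+ 2) ^+ 2 = 0 -> y ^+ 2 = x ^+ 3 - g ^+ 2 * x ->
  x \in K /\ exists c, [/\ c \in K, c != 0 & y = c * y1].
Proof.
move=> gK iK sqK muK hx hy.
have x2K : x2 \in K.
  have -> : x2 = g / (g / x2) by field; rewrite g0 x2_neq0.
  by rewrite rpred_div.
have x1K : x1 \in K.
  have -> : x1 = (g / x2) * g / sq by rewrite /root_m3; field; rewrite g0 x2_neq0 x1_neq0.
  by rewrite rpred_div // rpredM.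
have m0K : m0 \in K.
  rewrite rpred_div ?two_mem //; apply: rpredD; first by rewrite rpredD ?rpred1.
  by rewrite rpredM ?rpredB ?rpred1 // rpredM ?two_mem.
have i0 : ii != 0 by rewrite -sqrf_eq0 root_m1E oppr_eq0 oner_eq0.
have m00 : m0 != 0.
  rewrite -sqrf_eq0 m0_sqr -oppr_eq0 opprB; apply/eqP => h.
  by have := sq_ii; rewrite h mulr0 => /eqP; rewrite eq_sym oner_eq0.
have root c : c \in K -> c != 0 -> y ^+ 2 = (c * y1) ^+ 2 ->
    exists c, [/\ c \in K, c != 0 & y = c * y1].
  move=> cK c0 /eqP; rewrite eqf_sqr => /orP [] /eqP ->; first by exists c.
  by exists (- c); rewrite rpredN oppr_eq0 mulNr.
have : (x ^+ 2 == x1 ^+ 2) || (x ^+ 2 == x2 ^+ 2).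
  have : 3 * (x ^+ 2 - x1 ^+ 2) * (x ^+ 2 - x2 ^+ 2) = 0.
    have -> : x2 ^+ 2 = 2 * g ^+ 2 - x1 ^+ 2 by rewrite -quartic_sum; ring.
    by rewrite -[RHS](subrr 0) -{1}hx -hx1; ring.
  by move/eqP; rewrite !mulf_eq0 (negPf n3) !subr_eq0.
have e1 : (m0 * y1) ^+ 2 = x2 ^+ 3 - g ^+ 2 * x2.
  rewrite exprMn m0_sqr hy1.
  have -> : x2 ^+ 3 - g ^+ 2 * x2 = x2 * (x2 ^+ 2 - g ^+ 2) by ring.
  have -> : x2 ^+ 2 = 2 * g ^+ 2 - x1 ^+ 2 by rewrite -quartic_sum; ring.
  by rewrite x2_x1; ring.
have e2 : ii ^+ 2 = - 1 := root_m1E.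
rewrite !eqf_sqr -!orbA => /or4P [] /eqP ex; (split; first by rewrite ex ?rpredN).
- by apply: (root 1); rewrite ?rpred1 ?oner_neq0 // mul1r hy1 hy ex.
- by apply: (root ii) => //; rewrite exprMn e2 hy1 hy ex; ring.
- by apply: (root m0) => //; rewrite e1 hy ex.
- apply: (root (ii * m0)); [exact: rpredM | exact: mulf_neq0 |].
  by rewrite -mulrA exprMn e1 e2 hy ex; ring.
Qed.

End ThreeTorsionField.

(** * The wild conductor exponent at 2 and at odd primes *)

Section WildAtTwo.

Variables (L : splittingFieldType rat) (v : L -> int) (w l p y1 theta c0 : L).
Variables (T : seq (wpoint L)) (r : int) (n : nat).
Hypotheses (hv : normalized_valuation 2 v).
Hypotheses (hw : w ^+ 2 = - w - 1) (hl : l ^+ 2 = 2 * l - 2).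
Hypothesis hp : p ^+ 2 = l + 2 * w - l * p.

Local Notation K1 := <<1; w>>%AS.
Local Notation K2 := <<K1; l>>%AS.
Local Notation K3 := <<K2; p>>%AS.
Local Notation mu := (l - 1 + l * p).

Hypotheses (uT : uniq T) (sT : size T = 9%N).
Hypothesis T_y1 : forall x y, Some (x, y) \in T ->
  x \in K3 /\ exists c, [/\ c \in K3, c != 0 & y = c * y1].
Hypothesis genT : <<1 & flatten [seq if P is Some (x, y) then [:: x; y] else [::]
                    | P <- T]>>%VS = fullv.
Hypotheses (hc0 : c0 \in K3 /\ c0 != 0) (hth : theta = c0 * y1).
Hypothesis hn : ramification_group v n = [set 1%g].

Let l0 : l != 0. Proof. exact: one_plus_i_neq0 hl. Qed.

Let l2 : l ^+ 2 != 0. Proof. exact: expf_neq0. Qed.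

Lemma generated_by (q : L) : theta \in <<K3; q>>%VS -> <<K3; q>>%VS = fullv.
Proof.
move=> hq; have [c0K c00] := hc0.
have y1K : y1 \in <<K3; q>>%AS.
  have -> : y1 = theta / c0 by rewrite hth mulrC mulKf.
  by apply: rpred_div => //; apply: subvP_adjoin.
apply/eqP; rewrite eqEsubv subvf /= -genT; apply/Fadjoin_seqP; split.
  exact: sub1v.
move=> z /flattenP [_ /mapP [[[x y]|] PT ->]] //.
have [xK [c [cK _ yE]]] := T_y1 PT.
rewrite !inE => /orP [] /eqP ->; first exact: subvP_adjoin.
by rewrite yE; apply: rpredM y1K; apply: subvP_adjoin.
Qed.

Lemma theta_generates (q : L) : q \in <<K3; theta>>%VS -> q \in <<K3; y1>>%VS.
Proof.
apply: subvP; apply/FadjoinP; split; first exact: subv_adjoin.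
have [c0K _] := hc0; rewrite hth; apply: (@rpredM _ <<K3; y1>>%AS).
  exact: subvP_adjoin.
exact: memv_adjoin.
Qed.

Let T_y1' x y : Some (x, y) \in T -> exists2 c, c \in K3 & y = c * y1 /\ c != 0.
Proof. by move=> /T_y1 [_ [c [cK c1 c2]]]; exists c. Qed.

Lemma K3_gens : [/\ w \in K3, l \in K3 & p \in K3].
Proof. by split; [exact: w_mem3 | exact: l_mem3 | exact: p_mem3]. Qed.

Let wge := vge_cube_root hv hw.
Let lge := vge_l hv hw hl hp.
Let pge := vge_p hv hw hl hp.

Let vint (z : int) : vge v 0 z%:~R := vge_int hv z.
Let vnat (m : nat) : vge v 0 m%:R := vge_nat hv m.

(** The case [k = 4]: the trace [(2 - l) m] has the valuation of [l]. *)
Lemma wild_sum_odd : theta ^+ 2 = (1 + 8 * r%:~R) * mu ->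
  \sum_(1 <= i < n) #|ramification_group v i|%:R / #|ramification_group v 0|%:R
     * (2 - logn 3 (size (fixed_points T (ramification_group v i))))%:R
  = 3 :> rat.
Proof.
move=> th2.
(* [theta^2 - m^2] has valuation 10, so [theta - m] has valuation 5, against 4
   for [l]. *)
pose m := 1 + p + w * l; pose q := (theta - m) / l.
pose rr : L := r%:~R.
pose eps := l - 1.
pose nu := (1 - l) * ((2 - l) * w ^+ 2 + 1 + p * (1 - w) + 2 * rr * (2 - l) * mu).
have mem3 : [/\ m \in K3, eps \in K3 & nu \in K3].
  have [wK lK pK] := K3_gens; have K2 := two_mem K3; have K1 := rpred1 K3.
  have rK : rr \in K3 := rpred_int K3 r.
  have muK : mu \in K3 by apply: rpredD; [apply: rpredB | apply: rpredM].
  split; first by apply: rpredD; [apply: rpredD | apply: rpredM].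
    exact: rpredB.
  apply: rpredM; first exact: rpredB.
  apply: rpredD; first apply: rpredD; first apply: rpredD => //.
  - by apply: rpredM; [apply: rpredB | apply: rpredX].
  - by apply: rpredM => //; apply: rpredB.
  - by apply: rpredM => //; apply: rpredM; [apply: rpredM | apply: rpredB].
have thE : theta = m + l * q by rewrite /q mulrC divfK ?subrKC // addrC subrK.
have hq : q * (q + (2 - l) * m) = p * eps + l * nu.
  apply: (mulfI l2); transitivity (theta ^+ 2 - m ^+ 2).
    by rewrite thE; ring: hl.
  by rewrite th2 /m /eps /nu -/rr; ring: hl hp hw.
have mge : vge v 0 m by rewrite !(vgeD hv) ?(vgeM0 hv) // (vnat 1).
have muge : vge v 0 mu by rewrite !(vgeD hv) ?(vgeM0 hv) // (vgeN hv) (vnat 1).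
have n1ge : vge v 0 (1 - l) by rewrite (vgeB hv) // (vnat 1).
have n2ge : vge v 0 (2 - l) by rewrite (vgeB hv).
have wge' : vge v 0 (1 - w) by rewrite (vgeB hv) // (vnat 1).
have nuge : vge v 0 nu.
  rewrite /nu (vgeM0 hv) // !(vgeD hv) ?(vnat 1) //.
  - by rewrite (vgeM0 hv) // (vgeX hv).
  - by rewrite (vgeM0 hv).
  - by do ?[apply: (vgeM0 hv) => //]; apply: vint.
have epsu : veq v 0 eps.
  have [D [D0 _ hD _]] := middle_uniformizer hv hw hl hp.
  apply: (veqDr hv (veq_ge hD) (veqN1 hv)); clear -D0; lia.
have genL : <<K3; q>>%VS = fullv.
  have [wK lK pK] := K3_gens; have [bK _ _] := mem3.
  apply: generated_by; rewrite thE; apply: (@rpredD _ <<K3; q>>%AS).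
    exact: subvP_adjoin.
  by apply: (@rpredM _ <<K3; q>>%AS); [apply: subvP_adjoin | apply: memv_adjoin].
have qy1 : q \in <<K3; y1>>%VS.
  have [wK lK pK] := K3_gens; have [bK _ _] := mem3.
  apply: theta_generates; apply: (@rpred_div _ <<K3; theta>>%AS).
    by apply: (@rpredB _ <<K3; theta>>%AS); [apply: memv_adjoin | apply: subvP_adjoin].
  exact: subvP_adjoin.
have [hq1 hp2 hl4 h28] := tower_values hv hw hl hp hq erefl genL mem3 mge epsu nuge.
have hk : veq v 4%N ((2 - l) * m).
  rewrite -[Posz 4]addr0 (veqM hv) //.
    by apply: (veqDr hv (veq_ge h28)); rewrite ?(veqN hv).
  rewrite /m -addrA; apply: (veqD hv (n := 2) (veq1 hv)) => //.
  rewrite (vgeD hv) ?(veq_ge hp2) // (vgeMr hv) //.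
  by apply: vgeW (veq_ge hl4).
by rewrite (wild_sum hv hw hl hp hq erefl genL mem3 mge epsu nuge _ hk uT sT qy1).
Qed.

(** The case [k = 6]: multiplying [mu] by [- i = 1 - l] brings its square root
    closer to 1, and the trace becomes [(2 - l) p]. *)
Lemma wild_sum_even : theta ^+ 2 = (1 + 8 * r%:~R) * (1 - l) * mu ->
  \sum_(1 <= i < n) #|ramification_group v i|%:R / #|ramification_group v 0|%:R
     * (2 - logn 3 (size (fixed_points T (ramification_group v i))))%:R
  = 4 :> rat.
Proof.
move=> th2.
(* [theta^2 - 1] has valuation 6, so [theta - 1] has valuation 3; [p / l] has
   valuation -2. *)
pose q := (theta - 1) * p / l; pose rr : L := r%:~R.
pose e1 := 1 + (2 - l) * w - p.
pose eps := (1 - l) * e1.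
pose nu := e1 * (2 * rr * (2 - l) ^+ 2 * (1 - l) * mu).
have mem3 : [/\ p \in K3, eps \in K3 & nu \in K3].
  have [wK lK pK] := K3_gens; have K2 := two_mem K3; have K1 := rpred1 K3.
  have rK : rr \in K3 := rpred_int K3 r.
  have muK : mu \in K3 by apply: rpredD; [apply: rpredB | apply: rpredM].
  have n1K : 1 - l \in K3 by exact: rpredB.
  have n2K : 2 - l \in K3 by exact: rpredB.
  have e1K : e1 \in K3.
    by apply: rpredB => //; apply: rpredD => //; apply: rpredM.
  split=> //; first exact: rpredM.
  apply: rpredM => //; apply: rpredM => //; apply: rpredM => //.
  by apply: rpredM; [apply: rpredM | apply: rpredX].
have p0 : p != 0.
  by have [D [_ hD _ _]] := middle_uniformizer hv hw hl hp; apply: veq0 hD.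
have thE : theta = 1 + l * q / p by rewrite /q; field; rewrite p0 l0.
have lqE : l * q = (theta - 1) * p by rewrite /q; field.
have hq : q * (q + (2 - l) * p) = p * eps + l * nu.
  apply: (mulfI l2); transitivity (p ^+ 2 * (theta ^+ 2 - 1)).
    transitivity ((l * q) * (l * q + 2 * p)); first by ring: hl.
    by rewrite lqE; ring.
  by rewrite th2 /eps /nu /e1 -/rr; ring: hl hp hw.
have muge : vge v 0 mu by rewrite !(vgeD hv) ?(vgeM0 hv) // (vgeN hv) (vnat 1).
have n1ge : vge v 0 (1 - l) by rewrite (vgeB hv) // (vnat 1).
have n2ge : vge v 0 (2 - l) by rewrite (vgeB hv).
have e1ge : vge v 0 e1.
  by rewrite (vgeB hv) // (vgeD hv) ?(vnat 1) // (vgeM0 hv).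
have nuge : vge v 0 nu.
  by do ?[apply: (vgeM0 hv) => //]; apply: vint.
have epsu : veq v 0 eps.
  have [D [D0 hD hD2 hD4]] := middle_uniformizer hv hw hl hp.
  have h2 : vge v (D + D) 2.
    by apply: vgeW (veq_ge (veq_two hv)); rewrite hD4; clear -D0; lia.
  rewrite -[0]addr0 (veqM hv) //.
    apply: (veqD hv (n := D + D) (veq1 hv)); last by clear -D0; lia.
    by rewrite (vgeN hv) (veq_ge hD2).
  rewrite /e1 -addrA; apply: (veqD hv (n := D) (veq1 hv)) => //.
  rewrite (vgeB hv) ?(veq_ge hD) // (vgeMl hv) //.
  by rewrite (vgeB hv) ?(vgeW _ h2) ?(vgeW _ (veq_ge hD2)) //; clear -D0; lia.
have genL : <<K3; q>>%VS = fullv.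
  have [wK lK pK] := K3_gens; have [bK _ _] := mem3.
  apply: generated_by; rewrite thE; apply: (@rpredD _ <<K3; q>>%AS).
    exact: rpred1.
  apply: (@rpred_div _ <<K3; q>>%AS); last exact: subvP_adjoin.
  by apply: (@rpredM _ <<K3; q>>%AS); [apply: subvP_adjoin | apply: memv_adjoin].
have qy1 : q \in <<K3; y1>>%VS.
  have [wK lK pK] := K3_gens; have [bK _ _] := mem3.
  apply: theta_generates; apply: (@rpred_div _ <<K3; theta>>%AS).
    apply: (@rpredM _ <<K3; theta>>%AS); last exact: subvP_adjoin.
    by apply: (@rpredB _ <<K3; theta>>%AS); [apply: memv_adjoin | apply: rpred1].
  exact: subvP_adjoin.
have [hq1 hp2 hl4 h28] := tower_values hv hw hl hp hq erefl genL mem3 pge epsu nuge.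
have hk : veq v 6%N ((2 - l) * p).
  rewrite -[Posz 6]/(4 + 2 : int) (veqM hv) //.
  by apply: (veqDr hv (veq_ge h28)); rewrite ?(veqN hv).
by rewrite (wild_sum hv hw hl hp hq erefl genL mem3 pge epsu nuge _ hk uT sT qy1).
Qed.

End WildAtTwo.

Lemma map_congruent_curve (L : fieldExtType rat) (G : rat) :
  map_wcurve (fun a : rat => a%:A : L) (WCurve 0 0 0 (- G ^+ 2) 0) =
  WCurve 0 0 0 (- (G%:A : L) ^+ 2) 0.
Proof.
rewrite /map_wcurve /= scale0r scaleNr; congr (WCurve _ _ _ (- _) _).
by rewrite -!/(in_alg L _) rmorphXn.
Qed.

(** For a given value of [x^2] there are at most four affine points. *)
Lemma two_abscissas (L : fieldType) (A : L) (T : seq (wpoint L)) :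
  uniq T -> size T = 9%N ->
  (forall x y, Some (x, y) \in T -> y ^+ 2 = x ^+ 3 - A * x) ->
  exists x1 y1 x2 y2, [/\ Some (x1, y1) \in T, Some (x2, y2) \in T & x1 ^+ 2 != x2 ^+ 2].
Proof.
move=> uT sT hT.
have le9 s : (size s < 9)%N -> {subset T <= s} -> False.
  by move=> lt sub; have := uniq_leq_size uT sub; rewrite sT leqNgt lt.
have [[x1 y1] P1] : exists P : L * L, Some P \in T.
  case some: (has isSome T); first by case/hasP: some => -[P|] // PT _; exists P.
  case: (@le9 [:: None]) => // P PT; rewrite inE.
  by case: P PT => // P PT; case/hasP: some; exists (Some P).
case h2: (has (fun P : wpoint L => if P is Some (x, _) then x ^+ 2 != x1 ^+ 2 else false) T).
  case/hasP: h2 => -[[x2 y2]|] // P2 ne; exists x1, y1, x2, y2.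
  by rewrite P1 P2 eq_sym.
have sq x y : Some (x, y) \in T -> (x == x1) || (x == - x1).
  move=> P; rewrite -eqf_sqr; apply: contraFT h2 => ne.
  by apply/hasP; exists (Some (x, y)).
have [y' hy'] : exists y', forall y, Some (- x1, y) \in T -> (y == y') || (y == - y').
  case h3: (has (fun P : wpoint L => if P is Some (x, _) then x == - x1 else false) T).
    case/hasP: h3 => -[[x y']|] // P' /eqP ex; exists y' => y Py.
    by rewrite -eqf_sqr (hT _ _ Py) (hT _ _ P') ex.
  exists 0 => y Py; case/hasP: h3; exists (Some (- x1, y)) => //; exact: eqxx.
case: (@le9 [:: None; Some (x1, y1); Some (x1, - y1); Some (- x1, y'); Some (- x1, - y')]) => //.
move=> [[x y]|] PT; last by rewrite inE.
have := sq _ _ PT; rewrite !inE => /orP [] /eqP ex; rewrite ex in PT *.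
  have : (y == y1) || (y == - y1) by rewrite -eqf_sqr (hT _ _ PT) (hT _ _ P1).
  by case/orP => /eqP ->; rewrite eqxx ?orbT.
by case/orP: (hy' _ PT) => /eqP ->; rewrite eqxx ?orbT.
Qed.

(** Odd integers are [1], [-1], [3] or [-3] modulo 8, and these are squares
    in [Q(i, sqrt -3)]: this is why only the parity matters in the end. *)
Lemma odd_twist (L : fieldExtType rat) (K : {subfield L}) (ii sq : L) (k : int) :
  ii \in K -> sq \in K -> ii ^+ 2 = -1 -> sq ^+ 2 = -3 -> odd `|k|%N ->
  exists u r, [/\ u \in K, u != 0 & k%:~R * u ^+ 2 = 1 + 8 * r%:~R].
Proof.
move=> iK sK i2 s2 ok.
have i0 : ii != 0 by rewrite -sqrf_eq0 i2 oppr_eq0 oner_eq0.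
have s0 : sq != 0 by rewrite -sqrf_eq0 s2 oppr_eq0 (natr_neq0 L 2).
have gen (u : L) (m : int) : u \in K -> u != 0 -> u ^+ 2 = m%:~R -> (k * m = 1 %[mod 8])%Z ->
    exists u r, [/\ u \in K, u != 0 & k%:~R * u ^+ 2 = 1 + 8 * r%:~R].
  move=> uK u0 u2 km; exists u, ((k * m - 1) %/ 8)%Z; split=> //.
  rewrite u2 -(intrM _ k) -(intrM _ 8) -(intrD _ 1); congr (_%:~R).
  by move: (k * m) km; clear; lia.
have [h|[h|[h|h]]] : (k = 1 %[mod 8])%Z \/ (k = 3 %[mod 8])%Z \/
    (k = 5 %[mod 8])%Z \/ (k = 7 %[mod 8])%Z.
  by move: ok; clear; lia.
- by apply: (gen 1 1); rewrite ?rpred1 ?oner_neq0 ?expr1n //; move: h; clear; lia.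
- apply: (gen (ii * sq) 3); rewrite ?rpredM ?mulf_neq0 //.
    by rewrite exprMn i2 s2; ring.
  by move: h; clear; lia.
- by apply: (gen sq (- 3)); rewrite ?s2 //; move: h; clear; lia.
- by apply: (gen ii (- 1)); rewrite ?i2 //; move: h; clear; lia.
Qed.

Section WildExponentTwo.

Variables (G d : rat).
Hypothesis G0 : G != 0.
Hypothesis hd : wild_exponent (WCurve 0 0 0 (- G ^+ 2) 0) 2 3 d.

(** The 3-torsion data shared by both parities; only the normalisation of [y1]
    depends on the parity. *)
Lemma wild_exponent_data : exists (L : splittingFieldType rat) (v : L -> int)
    (w l p y1 : L) (T : seq (wpoint L)) (n : nat),
  [/\ normalized_valuation 2 v,
      [/\ w ^+ 2 = - w - 1, l ^+ 2 = 2 * l - 2 & p ^+ 2 = l + 2 * w - l * p],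
      [/\ uniq T, size T = 9%N,
       forall x y, Some (x, y) \in T -> x \in <<<<<<1; w>>; l>>; p>>%VS /\
         exists c, [/\ c \in <<<<<<1; w>>; l>>; p>>%VS, c != 0 & y = c * y1]
       & <<1 & flatten [seq if P is Some (x, y) then [:: x; y] else [::]
                    | P <- T]>>%VS = fullv],
      ramification_group v n = [set 1%g] /\
      d = \sum_(1 <= i < n) #|ramification_group v i|%:R / #|ramification_group v 0|%:R
        * (2 - logn 3 (size (fixed_points T (ramification_group v i))))%:R
    & (y1 * (1 + 2 * w)) ^+ 2 = G%:A ^+ 3 * l ^+ 2 * (l - 1 + l * p)].
Proof.
case: hd => L [T [v [n [[uT sT hT genT] hv hn dE]]]].
rewrite map_congruent_curve in hT; set g : L := G%:A in hT.
have g0 : g != 0 by rewrite -[g]/(in_alg L G) fmorph_eq0.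
have n2 := natr_neq0 L 1.
have on x y : Some (x, y) \in T -> y ^+ 2 = x ^+ 3 - g ^+ 2 * x.
  by move/hT => []; rewrite on_congruentE => /eqP.
have quart x y : Some (x, y) \in T -> 3 * x ^+ 4 - 6 * g ^+ 2 * x ^+ 2 - (g ^+ 2) ^+ 2 = 0.
  by move/hT => []; apply: three_torsionP.
have [x1 [y1 [x2 [y2 [P1 P2 ne]]]]] := two_abscissas uT sT on.
have hx1 := quart _ _ P1; have hx2 := quart _ _ P2; have hy1 := on _ _ P1.
pose w := tower_w g x1 x2; pose l := tower_l g x1 x2; pose p := tower_p g x1 x2.
pose K := <<<<<<1; w>>; l>>; p>>%AS.
have wK : w \in K := w_mem3 w l p.
have lK : l \in K := l_mem3 w l p.
have pK : p \in K := p_mem3 w l p.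
exists L, v, w, l, p, y1, T, n; split=> //.
- split; [exact: tower_wE g0 hx1 hx2 ne | exact: tower_lE g0 hx1 hx2 ne | exact: tower_pE g0 hx1 hx2 ne].
- split=> // x y P; apply: (torsion_coordinates g0 hx1 hx2 ne hy1 _ _ _ _ (quart _ _ P) (on _ _ P)).
  + by apply: subvP (sub1v K) _ _; apply/vlineP; exists G.
  + by rewrite (iiE g x1 x2) rpredB ?rpred1.
  + by rewrite (sqE g x1 x2) rpredD ?rpred1 // rpredM // two_mem.
  + rewrite (muE g0 hx1 hx2 ne); apply: rpredD; last exact: rpredM.
    by apply: rpredB lK _; apply: rpred1.
- exact: y1_sqr g0 hx1 hx2 ne hy1.
Qed.

Variables (h : rat) (k : int).
Hypotheses (h0 : h != 0) (Gk : G = h ^+ 2 * k%:~R).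

Lemma wild_exponent_two_odd : odd `|k|%N -> d = 3.
Proof.
move=> ok; have [L [v [w [l [p [y1 [T [n]]]]]]]] := wild_exponent_data.
case=> hv [hw hl hp] [uT sT hT genT] [hn ->] hy1.
set K := <<<<<<1; w>>; l>>; p>>%AS.
have wK : w \in K := w_mem3 w l p.
have lK : l \in K := l_mem3 w l p.
have [i2 s2] : (l - 1) ^+ 2 = -1 /\ (1 + 2 * w) ^+ 2 = -3 by split; ring: hl hw.
have iK : l - 1 \in K by rewrite rpredB ?rpred1.
have sK : 1 + 2 * w \in K by rewrite rpredD ?rpred1 // rpredM // two_mem.
have [u [r [uK u0 ur]]] := odd_twist iK sK i2 s2 ok.
have l0 := one_plus_i_neq0 hl.
have s0 : 1 + 2 * w != 0 by rewrite -sqrf_eq0 s2 oppr_eq0 (natr_neq0 L 2).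
have inj (a : rat) : a != 0 -> in_alg L a != 0 by rewrite fmorph_eq0.
have GL : in_alg L G = in_alg L h ^+ 2 * k%:~R by rewrite Gk rmorphM rmorphXn rmorph_int.
have ratK (a : rat) : in_alg L a \in K by apply: subvP (sub1v K) _ _; apply/vlineP; exists a.
pose c0 := u * (1 + 2 * w) / (in_alg L G * l * in_alg L h).
apply: (wild_sum_odd (theta := c0 * y1) (c0 := c0) (r := r) hv hw hl hp uT sT hT genT) => //.
  split; first by have GK := ratK G; have hK := ratK h; apply: rpred_div; apply: rpredM => //; apply: rpredM.
  by rewrite /c0 !mulf_neq0 ?invr_eq0 ?mulf_neq0 ?inj.
have -> : (c0 * y1) ^+ 2 = u ^+ 2 * (y1 * (1 + 2 * w)) ^+ 2 / (in_alg L G * l * in_alg L h) ^+ 2.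
  by rewrite /c0; field; rewrite l0 !inj.
rewrite hy1 -!/(in_alg L _) -ur; transitivity (u ^+ 2 * (in_alg L G / in_alg L h ^+ 2) * (l - 1 + l * p)).
  by field; rewrite l0 !inj.
by rewrite GL; field; rewrite inj.
Qed.

Lemma wild_exponent_two_even k1 : k = 2 * k1 -> odd `|k1|%N -> d = 4.
Proof.
move=> k2 ok; have [L [v [w [l [p [y1 [T [n]]]]]]]] := wild_exponent_data.
case=> hv [hw hl hp] [uT sT hT genT] [hn ->] hy1.
set K := <<<<<<1; w>>; l>>; p>>%AS.
have wK : w \in K := w_mem3 w l p.
have lK : l \in K := l_mem3 w l p.
have [i2 s2] : (l - 1) ^+ 2 = -1 /\ (1 + 2 * w) ^+ 2 = -3 by split; ring: hl hw.
have iK : l - 1 \in K by rewrite rpredB ?rpred1.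
have sK : 1 + 2 * w \in K by rewrite rpredD ?rpred1 // rpredM // two_mem.
have [u [r [uK u0 ur]]] := odd_twist iK sK i2 s2 ok.
have l0 := one_plus_i_neq0 hl.
have s0 : 1 + 2 * w != 0 by rewrite -sqrf_eq0 s2 oppr_eq0 (natr_neq0 L 2).
have inj (a : rat) : a != 0 -> in_alg L a != 0 by rewrite fmorph_eq0.
have GL : in_alg L G = in_alg L h ^+ 2 * ((1 - l) * l ^+ 2 * k1%:~R).
  rewrite Gk k2 rmorphM rmorphXn rmorph_int intrM; congr (_ * (_ * _)).
  by ring: hl.
have ratK (a : rat) : in_alg L a \in K by apply: subvP (sub1v K) _ _; apply/vlineP; exists a.
pose c0 := u * (1 + 2 * w) / (in_alg L G * l ^+ 2 * in_alg L h).
apply: (wild_sum_even (theta := c0 * y1) (c0 := c0) (r := r) hv hw hl hp uT sT hT genT) => //.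
  split; first by have GK := ratK G; have hK := ratK h; apply: rpred_div; apply: rpredM => //; apply: rpredM => //; apply: rpredX.
  by rewrite /c0 !mulf_neq0 ?invr_eq0 ?mulf_neq0 ?expf_neq0 ?inj.
have -> : (c0 * y1) ^+ 2 = u ^+ 2 * (y1 * (1 + 2 * w)) ^+ 2 / (in_alg L G * l ^+ 2 * in_alg L h) ^+ 2.
  by rewrite /c0; field; rewrite l0 !inj.
rewrite hy1 -!/(in_alg L _) -ur.
transitivity (u ^+ 2 * (in_alg L G / (l ^+ 2 * in_alg L h ^+ 2)) * (l - 1 + l * p)).
  by field; rewrite l0 !inj.
by rewrite GL; field; rewrite l0 inj.
Qed.

End WildExponentTwo.

(** All the 2-torsion is rational, so the Galois group that enters the
    definition is trivial. *)
Lemma wild_exponent_odd_prime (G d : rat) p : G != 0 ->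
  wild_exponent (WCurve 0 0 0 (- G ^+ 2) 0) p 2 d -> d = 0.
Proof.
move=> G0 [L [T [v [n [[uT sT hT genT] hv hn ->]]]]].
rewrite map_congruent_curve in hT; set g : L := G%:A in hT.
have g1 : g \in 1%VS by apply/vlineP; exists G.
have rat1 x y : Some (x, y) \in T -> x \in 1%VS /\ y \in 1%VS.
  move=> P; have [on /(two_torsionP (natr_neq0 L 1)) y0] := hT _ P.
  move: on; rewrite y0 on_congruentE expr0n eq_sym => /eqP e; split; last exact: mem0v.
  have /eqP : x * ((x - g) * (x + g)) = 0 by rewrite -[RHS]e; ring.
  rewrite !mulf_eq0 subr_eq0 addr_eq0 => /or3P [] /eqP -> //; first exact: mem0v.
  by rewrite rpredN.
have full : (1 = fullv :> {vspace L})%VS.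
  apply/eqP; rewrite eqEsubv subvf -genT; apply/Fadjoin_seqP; split=> //.
  move=> z /flattenP [_ /mapP [[[x y]|] PT ->]] //.
  by have [x1 y1] := rat1 _ _ PT; rewrite !inE => /orP [] /eqP ->.
rewrite big1_seq // => i _.
suff -> : fixed_points T (ramification_group v i) = T by rewrite sT mulr0.
rewrite /fixed_points (eq_in_filter (a2 := xpredT)) ?filter_predT // => P PT.
apply/forall_inP => s; rewrite inE => /andP [sG _].
case: P PT => [[x y]|] //= /rat1 [x1 y1].
by rewrite !(fixed_gal (sub1v _) sG).
Qed.

(** * Minimal equations *)

Definition wb8 (R : comNzRingType) (E : wcurve R) : R :=
  let: WCurve a1 a2 a3 a4 a6 := E in
  a1 ^+ 2 * a6 + 4 * a2 * a6 - a1 * a3 * a4 + a2 * a3 ^+ 2 - a4 ^+ 2.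

Definition wc4 (R : comNzRingType) (E : wcurve R) : R :=
  let: WCurve a1 a2 a3 a4 a6 := E in
  (a1 ^+ 2 + 4 * a2) ^+ 2 - 24 * (2 * a4 + a1 * a3).

Section WeierstrassMorphism.

Variables (R S : comNzRingType) (f : {rmorphism R -> S}).

Lemma wdisc_map E : wdisc (map_wcurve f E) = f (wdisc E).
Proof.
case: E => a1 a2 a3 a4 a6; rewrite /wdisc /map_wcurve /=.
by rewrite !(rmorph_nat, rmorphB, rmorphN, rmorphD, rmorphM, rmorphXn).
Qed.

Lemma wc4_map E : wc4 (map_wcurve f E) = f (wc4 E).
Proof.
case: E => a1 a2 a3 a4 a6; rewrite /wc4 /map_wcurve /=.
by rewrite !(rmorph_nat, rmorphB, rmorphN, rmorphD, rmorphM, rmorphXn).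
Qed.

Lemma wb8_map E : wb8 (map_wcurve f E) = f (wb8 E).
Proof.
case: E => a1 a2 a3 a4 a6; rewrite /wb8 /map_wcurve /=.
by rewrite !(rmorph_nat, rmorphB, rmorphN, rmorphD, rmorphM, rmorphXn).
Qed.

End WeierstrassMorphism.

Section CongruentChange.

Variables (F : fieldType) (g u r s t : F).
Hypothesis u0 : u != 0.

Local Notation E := (WCurve 0 0 0 (- g ^+ 2) 0).

Lemma wdisc_congruent : u ^+ 12 * wdisc (wchange u r s t E) = 64 * g ^+ 6.
Proof. by rewrite /wdisc /wchange; field. Qed.

Lemma wc4_congruent : u ^+ 4 * wc4 (wchange u r s t E) = 48 * g ^+ 2.
Proof. by rewrite /wc4 /wchange; field. Qed.

Lemma wb8_congruent :
  u ^+ 8 * wb8 (wchange u r s t E) = 3 * r ^+ 4 - 6 * g ^+ 2 * r ^+ 2 - g ^+ 4.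
Proof. by rewrite /wb8 /wchange; field. Qed.

Lemma wchange_scale (h : F) : h != 0 ->
  wchange u r s t (WCurve 0 0 0 (- (h ^+ 2 * g) ^+ 2) 0) =
  wchange (u / h) (r / h ^+ 2) (s / h) (t / h ^+ 3) E.
Proof. by move=> h0; rewrite /wchange; congr WCurve; field; rewrite u0 h0. Qed.

End CongruentChange.

(** Translating the singular point to the origin makes [b4] vanish and turns
    [b2] into [b2 + 12 x]. *)
Lemma wsingular_c4 (F : fieldType) (E : wcurve F) x y : wsingular E x y ->
  (wa1 E ^+ 2 + 4 * (wa2 E + 3 * x)) ^+ 2 = wc4 E.
Proof.
case: E => a1 a2 a3 a4 a6 /and3P [_ /eqP e1 /eqP e2] /=.
apply/eqP; rewrite -subr_eq0; apply/eqP.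
transitivity (24 * (2 * (3 * x ^+ 2 + 2 * a2 * x + a4 - a1 * y) + a1 * (2 * y + a1 * x + a3))).
  by ring.
by rewrite e1 e2 subrr; ring.
Qed.

(** The parity of [c4] is that of [a1], and an even [a1] makes both terms of
    [c4 = b2^2 - 24 b4] divisible by 16. *)
Lemma wc4_mod16 (W : wcurve int) : (2 %| wc4 W)%Z -> (16 %| wc4 W)%Z.
Proof.
case: W => a1 a2 a3 a4 a6; rewrite /wc4.
have [k [->|->]] : exists k, a1 = 2 * k \/ a1 = 2 * k + 1.
- by exists (a1 %/ 2)%Z; lia.
- have -> : ((2 * k) ^+ 2 + 4 * a2) ^+ 2 - 24 * (2 * a4 + 2 * k * a3) =
    16 * ((k ^+ 2 + a2) ^+ 2 - 3 * (a4 + k * a3)) by ring.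
  by move=> _; apply: dvdz_mulr.
- have -> : ((2 * k + 1) ^+ 2 + 4 * a2) ^+ 2 - 24 * (2 * a4 + (2 * k + 1) * a3) =
    2 * (8 * (k ^+ 2 + k + a2) ^+ 2 + 4 * (k ^+ 2 + k + a2) - 12 * (2 * a4 + (2 * k + 1) * a3)) + 1.
    by ring.
  by move: (8 * _ + _ - _) => z; lia.
Qed.

(** For [m] the numerator of the scale of a change of variables, the condition
    [m^12 | 64 g^6] amounts to [m^2 | 2 g]. *)
Lemma squarefree_dvd2 m g : squarefree g -> (m ^ 2 %| 2 * g)%N -> m = 1%N \/ m = 2%N /\ ~~ odd g.
Proof.
move=> [g0 sf] dv; case: (boolP (odd m)) => om.
  left; apply: sf; rewrite -(@Gauss_dvdr _ 2) // coprime_sym coprimeXr //.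
  by rewrite coprime2n.
right; have mE : m = (2 * m./2)%N by rewrite mul2n even_halfK.
have dv' : (2 * m./2 ^ 2 %| g)%N.
  by move: dv; rewrite {1}mE expnMn -[(2 ^ 2)%N]/(2 * 2)%N -mulnA dvdn_pmul2l.
have m1 : m./2 = 1%N by apply: sf; apply: dvdn_trans dv'; apply: dvdn_mull.
by split; [rewrite mE m1 | rewrite -dvdn2; apply: dvdn_trans dv'; apply: dvdn_mulr].
Qed.

Lemma squarefree_half g : squarefree g -> ~~ odd g -> odd g./2.
Proof.
move=> [_ /(_ 2%N) sf] eg; apply/negPn/negP => e; suff : (2 ^ 2 %| g)%N by move/sf.
by apply/dvdnP; exists g./2./2; rewrite -[LHS](even_halfK eg) -{1}(even_halfK e); lia.
Qed.

Lemma squarefree_double g : squarefree g -> odd g -> squarefree (2 * g).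
Proof.
move=> sf og; split=> [|j /(squarefree_dvd2 sf) [//|[_]]]; last by rewrite og.
by rewrite muln_gt0; case: sf.
Qed.

Lemma rat_of_denq1 (x : rat) : denq x = 1 -> x = (numq x)%:~R.
Proof. by move=> d1; rewrite -[LHS]divq_num_den d1 divr1. Qed.

Lemma rat_sqr_int (x : rat) (z : int) : x ^+ 2 = z%:~R -> exists m : int, x = m%:~R.
Proof.
move=> xz; exists (numq x); apply: rat_of_denq1.
have d0 : (denq x)%:~R != 0 :> rat by rewrite intr_eq0 denq_neq0.
have /eqP : (numq x ^+ 2)%:~R = (z * denq x ^+ 2)%:~R :> rat.
  rewrite rmorphXn [RHS]rmorphM /= rmorphXn /= -xz -{2}[x]divq_num_den expr_div_n divfK //.
  by rewrite expf_neq0.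
rewrite eqr_int => /eqP e.
have dv : (`|denq x| %| `|numq x| ^ 2)%N.
  by rewrite -abszX e abszM abszX; apply: dvdn_mull; apply: dvdn_exp.
have : (`|denq x| == 1)%N.
  rewrite -dvdn1 -(@Gauss_dvdr _ (`|numq x| ^ 2)) ?muln1 //.
  by rewrite coprimeXr // coprime_sym coprime_num_den.
by have := denq_gt0 x; lia.
Qed.

Section MinimalModel.

Variables (g : nat) (W : wcurve int) (u r s t : rat).
Hypotheses (sf : squarefree g) (u0 : u != 0).
Hypothesis hW : map_wcurve (fun n : int => n%:~R) W =
  wchange u r s t (WCurve 0 0 0 (- g%:R ^+ 2) 0).

Lemma scale_disc : u ^+ 12 * (wdisc W)%:~R = 64 * g%:R ^+ 6.
Proof. by rewrite -(wdisc_map (intmul 1)) hW wdisc_congruent. Qed.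

Lemma scale_c4 : u ^+ 4 * (wc4 W)%:~R = 48 * g%:R ^+ 2.
Proof. by rewrite -(wc4_map (intmul 1)) hW wc4_congruent. Qed.

(** If the numerator were 2, then [c4] would be [12] times an odd square, against
    [wc4_mod16]. *)
Lemma numq_scale : `|numq u|%N = 1%N.
Proof.
pose m := `|numq u|%N; pose n := `|denq u|%N.
have d0 : (denq u)%:~R != 0 :> rat by rewrite intr_eq0 denq_neq0.
have cop : coprime m n := coprime_num_den u.
have n0 : (0 < n)%N by rewrite absz_gt0 denq_neq0.
have eD : numq u ^+ 12 * wdisc W = denq u ^+ 12 * (64 * g%:Z ^+ 6).
  apply: (@intr_inj rat); rewrite !(rmorphXn, rmorphM) /=.
  have -> : 64 * (g%:Z)%:~R ^+ 6 = 64 * g%:R ^+ 6 :> rat by [].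
  by rewrite -scale_disc numqE; ring.
have eC : numq u ^+ 4 * wc4 W = denq u ^+ 4 * (48 * g%:Z ^+ 2).
  apply: (@intr_inj rat); rewrite !(rmorphXn, rmorphM) /=.
  have -> : 48 * (g%:Z)%:~R ^+ 2 = 48 * g%:R ^+ 2 :> rat by [].
  by rewrite -scale_c4 numqE; ring.
have dv : (m ^ 2 %| 2 * g)%N.
  rewrite -(@dvdn_pexp2r _ _ 6) // -expnM -(@Gauss_dvdr _ (n ^ 12)); last first.
    by rewrite coprimeXl // coprimeXr.
  have := congr1 absz eD; rewrite !(abszX, abszM) -/m -/n absz_nat expnMn => <-.
  exact: dvdn_mulr.
case: (squarefree_dvd2 sf dv) => // -[m2 eg]; exfalso.
have on : odd n by move: cop; rewrite m2 coprime2n.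
have gE : g = (2 * g./2)%N by rewrite mul2n even_halfK.
have og := squarefree_half sf eg.
have eC' : `|wc4 W|%N = (12 * (n ^ 4 * g./2 ^ 2))%N.
  have := congr1 absz eC; rewrite !(abszX, abszM) -/m -/n absz_nat m2 {1}gE expnMn.
  move: (n ^ 4)%N (g./2 ^ 2)%N => x y; clear; lia.
have oz : odd (n ^ 4 * g./2 ^ 2) by rewrite oddM !oddX on og.
have := @wc4_mod16 W; rewrite !dvdzE eC' /=.
by move: (_ * _)%N oz => z; clear; lia.
Qed.

Lemma scale_denominator : exists2 n : nat, (0 < n)%N & u ^+ 2 * n%:R ^+ 2 = 1.
Proof.
exists `|denq u|%N; first by rewrite absz_gt0 denq_neq0.
have -> : `|denq u|%N%:R = (denq u)%:~R :> rat by rewrite pmulrn absz_denq.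
rewrite -exprMn -numqE -rmorphXn.
have [->|->] : numq u = 1 \/ numq u = -1; last by [].
  by have := numq_scale; clear; lia.
by [].
Qed.

Lemma wdisc_scale : exists2 n : nat, (0 < n)%N &
  u ^+ 2 * n%:R ^+ 2 = 1 /\ wdisc W = n%:Z ^+ 12 * (64 * g%:Z ^+ 6).
Proof.
have [n n0 un] := scale_denominator; exists n => //; split=> //.
apply: (@intr_inj rat); rewrite !(rmorphXn, rmorphM) /=.
have -> : 64 * (g%:Z)%:~R ^+ 6 = 64 * g%:R ^+ 6 :> rat by [].
rewrite -scale_disc mulrA.
have -> : n%:R ^+ 12 * u ^+ 12 = (u ^+ 2 * n%:R ^+ 2) ^+ 6 :> rat by ring.
by rewrite un expr1n mul1r.
Qed.

Lemma wdisc_lower_bound : 64 * g%:Z ^+ 6 <= `|wdisc W|.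
Proof.
have [n n0 [_ ->]] := wdisc_scale.
have n12 : 0 < n%:Z ^+ 12 by rewrite exprn_gt0.
have : 0 <= 64 * g%:Z ^+ 6 by rewrite mulr_ge0 // exprn_ge0.
move: (n%:Z ^+ 12) n12 (64 * _ ^+ 6) => x x0 y y0; have xy : 0 <= x * y := mulr_ge0 (ltW x0) y0.
by rewrite (ger0_norm xy) ler_peMl //; move: x0; clear; lia.
Qed.

Lemma scale_unit : `|wdisc W| <= 64 * g%:Z ^+ 6 -> u ^+ 2 = 1.
Proof.
have [n n0 [un ->]] := wdisc_scale; have [g0 _] := sf.
have : 0 < 64 * g%:Z ^+ 6 by rewrite mulr_gt0 // exprn_gt0.
move: (64 * _ ^+ 6) => y y0; rewrite normrM (gtr0_norm y0) ger_pMl // => le1.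
suff n1 : n = 1%N by move: un; rewrite n1 expr1n mulr1.
have : (n ^ 12 <= 1)%N by move: le1; rewrite normrX; clear; lia.
by case: n n0 {un le1} => [//|[//|n]] _; rewrite leqNgt ltn_expl // (ltn_trans _ (ltn_expl _ _)).
Qed.

(** [b8] gives a quartic equation for [r] with leading coefficient 3, so the
    square of its denominator divides 3; [a2] and [a6] then give [s^2] and
    [t^2]. *)
Lemma change_integral : u ^+ 2 = 1 -> exists u' r' s' t' : int,
  [/\ u = u'%:~R, r = r'%:~R, s = s'%:~R & t = t'%:~R].
Proof.
move=> u2.
have [u' uE] := rat_sqr_int (z := 1) u2.
have u8 : u ^+ 8 = 1 by rewrite -[8%N]/(2 * 4)%N exprM u2 expr1n.
have u6 : u ^+ 6 = 1 by rewrite -[6%N]/(2 * 3)%N exprM u2 expr1n.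
have e8 : (wb8 W)%:~R = 3 * r ^+ 4 - 6 * g%:R ^+ 2 * r ^+ 2 - g%:R ^+ 4 :> rat.
  by have := wb8_congruent g%:R r s t u0; rewrite u8 mul1r -hW (wb8_map (intmul 1)).
have rE : r = (numq r)%:~R.
  apply: rat_of_denq1; set m := numq r; set d := denq r.
  have e : 3 * m ^+ 4 = d ^+ 2 * (d ^+ 2 * wb8 W + 6 * g%:Z ^+ 2 * m ^+ 2 + d ^+ 2 * g%:Z ^+ 4).
    apply: (@intr_inj rat); rewrite !(rmorphXn, rmorphM, rmorphD) /= -pmulrn e8 /m numqE -/d.
    by ring.
  have dv : (`|d| ^ 2 %| 3)%N.
    have : (`|d| ^ 2 %| 3 * `|m| ^ 4)%N.
      by have := congr1 absz e; rewrite !(abszX, abszM) => ->; apply: dvdn_mulr.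
    rewrite Gauss_dvdl // coprimeXl // coprimeXr // coprime_sym; exact: coprime_num_den.
  have d0 : 0 < d := denq_gt0 r.
  have : (`|d| ^ 2 <= 3)%N by apply: dvdn_leq dv.
  by clear -d0; move: d d0 => d d0; nia.
case: W hW => a1 a2 a3 a4 a6 /= [_ h2 _ _ h6].
have [s' sE] : exists s' : int, s = s'%:~R.
  apply: (rat_sqr_int (z := 3 * numq r - a2)).
  by rewrite rmorphB rmorphM /= h2 -rE u2 divr1; ring.
have [t' tE] : exists t' : int, t = t'%:~R.
  apply: (rat_sqr_int (z := - numq r * g%:Z ^+ 2 + numq r ^+ 3 - a6)).
  rewrite rmorphB rmorphD rmorphM rmorphN !rmorphXn /= h6 -rE u6 divr1; ring.
by exists u', (numq r), s', t'.
Qed.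

End MinimalModel.

(** * The conductor *)

Section TameExponent.

Variables (F : fieldType) (g u r s t : F).
Hypotheses (u2 : u ^+ 2 = 1) (g2 : 2 * g = 0).

Let W := WCurve (2 * s * u) (3 * r - s ^+ 2) (2 * t * u)
  (- g ^+ 2 + 3 * r ^+ 2 - 2 * s * t) (- r * g ^+ 2 + r ^+ 3 - t ^+ 2).

(** The image of [(g, 0)], where [y^2 = x^3 - g^2 x] is singular as soon as
    [2 g = 0]: this treats the prime 2 together with the divisors of [g]. *)
Lemma cusp_point : wsingular W (g - r) (u * (- s * (g - r) - t)).
Proof.
have e : 2 * g ^+ 2 = 0 by rewrite expr2 mulrA g2 mul0r.
apply/and3P; split; apply/eqP.
- by ring: u2.
- by ring.
- apply/eqP; rewrite -subr_eq0; apply/eqP.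
  by rewrite -[RHS]oppr0 -e; ring: u2.
Qed.

(** [c4 = 48 g^2] vanishes. *)
Lemma no_node x y : ~~ wnode W x y.
Proof.
rewrite /wnode negb_and negbK -implybE; apply/implyP => /wsingular_c4 e.
rewrite -sqrf_eq0 e /W /wc4; apply/eqP.
transitivity (24 * g * (2 * g)); first by ring: u2.
by rewrite g2 mulr0.
Qed.

End TameExponent.

Lemma tame_exponent_congruent (g : nat) (W : wcurve int) (u r s t : int) (p : nat) :
  u ^+ 2 = 1 -> map_wcurve (fun n : int => n%:~R) W =
    wchange u%:~R r%:~R s%:~R t%:~R (WCurve 0 0 0 (- g%:R ^+ 2) 0) :> wcurve rat ->
  prime p -> (p %| 2 * g)%N -> tame_exponent W p = 2%N.
Proof.
move=> u2 hW pp pg; rewrite /tame_exponent.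
have uq : (u%:~R : rat) ^+ 2 = 1 by rewrite -rmorphXn u2.
have u0 : u%:~R != 0 :> rat by rewrite -sqrf_eq0 uq oner_eq0.
have WE : W = WCurve (2 * s * u) (3 * r - s ^+ 2) (2 * t * u)
  (- g%:Z ^+ 2 + 3 * r ^+ 2 - 2 * s * t) (- r * g%:Z ^+ 2 + r ^+ 3 - t ^+ 2).
  have vE : (u%:~R : rat)^-1 = u%:~R by apply: (mulfI u0); rewrite divff // -expr2.
  case: W hW => a1 a2 a3 a4 a6 /= [e1 e2 e3 e4 e6].
  by congr WCurve; apply: (@intr_inj rat);
    rewrite !(rmorph_nat, rmorphXn, rmorphM, rmorphN, rmorphB, rmorphD) /= ?(e1, e2, e3, e4, e6) -?exprVn ?vE -?pmulrn; ring: uq.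
pose f (n : int) : 'F_p := n%:~R.
have g2 : 2 * (g%:R : 'F_p) = 0.
  by apply/eqP; rewrite -natrM -(dvdn_pcharf (pchar_Fp pp)).
have u2p : (u%:~R : 'F_p) ^+ 2 = 1 by rewrite -rmorphXn u2.
have -> : map_wcurve (fun n : int => n%:~R : 'F_p) W =
  WCurve (2 * s%:~R * u%:~R) (3 * r%:~R - s%:~R ^+ 2) (2 * t%:~R * u%:~R)
   (- g%:R ^+ 2 + 3 * r%:~R ^+ 2 - 2 * s%:~R * t%:~R) (- r%:~R * g%:R ^+ 2 + r%:~R ^+ 3 - t%:~R ^+ 2).
  rewrite WE /map_wcurve /=.
  by rewrite !(rmorph_nat, rmorphXn, rmorphM, rmorphN, rmorphB, rmorphD) /=.
rewrite ifN; last first.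
  rewrite negbK; apply/existsP; eexists; apply/existsP; eexists; exact: cusp_point u2p g2.
rewrite ifN //; apply/existsPn => x; apply/existsPn => y; exact: no_node.
Qed.

Lemma squarefree_partP n : (0 < n)%N ->
  squarefree (squarefree_part n) /\ exists2 k, (0 < k)%N & n = (squarefree_part n * k ^ 2)%N.
Proof.
move=> n0; rewrite /squarefree_part; set M := (\max_(k < n.+1 | _) _)%N.
have [k kdv ME] : exists2 k : nat, (k ^ 2 %| n)%N & M = (k ^ 2)%N.
  have i0 : (1 < n.+1)%N by [].
  have [|k kd ME] := @eq_bigmax_cond _ (fun k : 'I_n.+1 => (k ^ 2 %| n)%N) (fun k : 'I_n.+1 => (k ^ 2)%N).
    by apply/card_gt0P; exists (Ordinal i0); rewrite unfold_in /= dvd1n.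
  by exists k => //; rewrite -ME.
have k0 : (0 < k)%N by case: (posnP k) kdv => // ->; rewrite exp0n // dvd0n eqn0Ngt n0.
have k20 : (0 < k ^ 2)%N by rewrite expn_gt0 k0.
rewrite ME; split; last by exists k => //; rewrite divnK.
split=> [|j]; first by rewrite divn_gt0 // dvdn_leq.
rewrite dvdn_divRL // -expnMn => dv.
have jk : (j * k < n.+1)%N.
  rewrite ltnS; apply: leq_trans (dvdn_leq n0 dv).
  by rewrite -mulnn; case: (j * k)%N => // m; rewrite leq_pmulr.
have : ((j * k) ^ 2 <= M)%N := @leq_bigmax_cond _ _ (fun k : 'I_n.+1 => (k ^ 2)%N) (Ordinal jk) dv.
have j0 : (0 < j)%N by case: (posnP j) dv => // ->; rewrite mul0n exp0n // dvd0n eqn0Ngt n0.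
rewrite ME leq_exp2r // -[X in (_ <= X)%N]mul1n leq_pmul2r // => j1.
by apply/eqP; rewrite eqn_leq j1.
Qed.

Lemma prod_primes_squarefree m : squarefree m -> (\prod_(p <- primes m) p)%N = m.
Proof.
move=> [m0 sf]; rewrite [RHS](prod_prime_decomp m0) prime_decompE big_map /=.
apply: eq_big_seq => p; rewrite mem_primes => /and3P [pp _ pm].
suff -> : logn p m = 1%N by rewrite expn1.
have : (0 < logn p m)%N by rewrite logn_gt0 mem_primes pp m0 pm.
case: (ltnP 1 (logn p m)) => [l2 _|]; last by case: (logn p m) => [|[|]].
by have := sf p; rewrite pfactor_dvdn // l2 => /(_ isT) p1; rewrite p1 in pp.
Qed.

Lemma conductor_product m e (f : nat -> nat) : squarefree m -> (2 %| m)%N ->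
  {in primes m, forall p, f p = (if p == 2 then 2 + e else 2)%N} ->
  (\prod_(p <- primes m) p ^ f p)%N = (m ^ 2 * 2 ^ e)%N.
Proof.
move=> sm m2 hf; have [m0 _] := sm.
have m2' : 2%N \in primes m by rewrite mem_primes m0.
rewrite (bigD1_seq 2%N) ?primes_uniq //= hf // eqxx.
have mE := prod_primes_squarefree sm.
rewrite (bigD1_seq 2%N) ?primes_uniq //= in mE.
have -> : (\prod_(i <- primes m | i != 2) i ^ f i = (\prod_(i <- primes m | i != 2) i) ^ 2)%N.
  rewrite (big_morph (expn^~ 2) (fun x y => expnMn x y 2) (exp1n 2)).
  rewrite big_seq_cond [RHS]big_seq_cond; apply: eq_bigr => p /andP [pm /negPf p2].
  by rewrite hf // p2.
by rewrite -{2}mE expnMn expnD mulnAC.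
Qed.

Section CongruentJacobian.

Variables (g : nat) (k : int) (h : rat).
Hypotheses (sf : squarefree g) (kg : `|k|%N = g) (h0 : h != 0).

Local Notation E := (WCurve 0 0 0 (- (h ^+ 2 * k%:~R) ^+ 2) 0 : wcurve rat).

Let k2 : (k%:~R : rat) ^+ 2 = g%:R ^+ 2.
Proof.
have [->|->] : k = g%:Z \/ k = - g%:Z by move: kg; clear; lia.
  by [].
by rewrite rmorphN sqrrN.
Qed.

Let g0 : (0 < g)%N. Proof. by case: sf. Qed.

Lemma congruent_change W : integral_model E W -> exists u r s t : rat,
  u != 0 /\ map_wcurve (fun n : int => n%:~R) W =
     wchange u r s t (WCurve 0 0 0 (- g%:R ^+ 2) 0).
Proof.
case=> u [r [s [t [u0 ->]]]].
exists (u / h), (r / h ^+ 2), (s / h), (t / h ^+ 3).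
split; first by rewrite mulf_neq0 ?invr_eq0.
by rewrite exprMn k2 -exprMn wchange_scale.
Qed.

Lemma congruent_integral_model :
  integral_model E (WCurve 0 0 0 (- g%:Z ^+ 2) 0).
Proof.
exists h, 0, 0, 0; split=> //; rewrite /map_wcurve /wchange /=.
rewrite rmorphN rmorphXn /= -pmulrn exprMn k2.
by congr WCurve; field.
Qed.

Lemma minimal_wdisc W : minimal_model E W -> `|wdisc W| = 64 * g%:Z ^+ 6.
Proof.
case=> iW mW; apply/eqP; rewrite eq_le.
have [u [r [s [t [u0 hW]]]]] := congruent_change iW.
rewrite (wdisc_lower_bound sf u0 hW) andbT.
apply: le_trans (mW _ congruent_integral_model) _.
have -> : wdisc (WCurve 0 0 0 (- g%:Z ^+ 2) 0) = 64 * g%:Z ^+ 6 by rewrite /wdisc; ring.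
by rewrite ger0_norm // mulr_ge0 // exprn_ge0.
Qed.

Lemma minimal_tame W p : minimal_model E W -> prime p -> (p %| 2 * g)%N ->
  tame_exponent W p = 2%N.
Proof.
move=> mW pp pg; have [iW _] := mW.
have [u [r [s [t [u0 hW]]]]] := congruent_change iW.
have u2 : u ^+ 2 = 1 by apply: (scale_unit sf u0 hW); rewrite (minimal_wdisc mW).
have [u' [r' [s' [t' [uE rE sE tE]]]]] := change_integral u0 hW u2.
apply: (@tame_exponent_congruent g W u' r' s' t' p) pp pg; last by rewrite -uE -rE -sE -tE; exact: hW.
by apply: (@intr_inj rat); rewrite rmorphXn /= -uE.
Qed.

Lemma conductor_exponent_congruent W p f : minimal_model E W -> prime p ->
  (p %| 2 * g)%N -> conductor_exponent E W p f ->
  f = (if p == 2 then 2 + (if odd g then 3 else 4) else 2)%N.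
Proof.
move=> mW pp pg [d hd]; rewrite (minimal_tame mW pp pg) => fE.
have k0 : k != 0 by rewrite -absz_gt0 kg.
have G0 : h ^+ 2 * k%:~R != 0 by rewrite mulf_neq0 ?expf_neq0 ?intr_eq0.
apply/eqP; rewrite -(eqr_nat rat) fE; apply/eqP.
move: hd; case: eqP => [p2|_ hd].
  rewrite p2 => hd; case: ifP => og.
    by rewrite (wild_exponent_two_odd G0 hd h0 erefl) ?kg.
  have kE : k = 2 * (k %/ 2)%Z by move: og; rewrite -kg; clear; lia.
  rewrite (wild_exponent_two_even G0 hd h0 erefl kE) //.
  by have := squarefree_half sf (negbT og); rewrite -kg; move: kE; clear; lia.
by rewrite (wild_exponent_odd_prime G0 hd) addr0.
Qed.

(** The primes dividing [64 g^6] are those of an even squarefree number, [2 g]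
    or [g]. *)
Lemma conductor_congruent N : conductor E N ->
  N = (if odd g then 32 * g ^ 2 else 16 * g ^ 2)%N.
Proof.
case=> W mW [f hf ->]; have wE := minimal_wdisc mW.
have DE : `|wdisc W|%N = (64 * g ^ 6)%N.
  by have := congr1 absz wE; rewrite absz_id !(abszX, abszM).
pose m := if odd g then (2 * g)%N else g.
have sm : squarefree m by rewrite /m; case: ifP => // og; apply: squarefree_double.
have m2 : (2 %| m)%N by rewrite /m; case: ifPn => [_|]; rewrite ?dvdn_mulr // dvdn2.
have pm : primes `|wdisc W| = primes m.
  apply/eq_primes => p; rewrite DE primesM ?expn_gt0 ?g0 // primesX //.
  rewrite (_ : primes 64 = primes 2) // /m; case: ifP => og; first by rewrite primesM.
  rewrite (_ : primes 2 = [:: 2]%N) // inE; case: eqP => // ->.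
  by rewrite mem_primes g0 dvdn2 og.
rewrite pm in hf *; rewrite (@conductor_product m (if odd g then 3 else 4)) //.
  by rewrite /m; case: ifP; rewrite ?expnMn; lia.
move=> p; move=> pp; apply: conductor_exponent_congruent mW _ _ (hf p pp).
  by move: pp; rewrite mem_primes => /and3P [].
move: pp; rewrite mem_primes => /and3P [_ _]; rewrite /m.
by case: ifP => // _ /dvdn_trans; apply; apply: dvdn_mull.
Qed.

Lemma szpiro_congruent (R : realType) (S : R) : szpiro_quotient E S ->
  S = if odd g
        then 3 - 9 * ln 2 / (2 * ln g%:R + 5 * ln 2)
        else 3 - 6 * ln 2 / (2 * ln g%:R + 4 * ln 2).
Proof.
case=> _ [N [[W mW ->] /conductor_congruent -> ->]].
rewrite (minimal_wdisc mW).
have gR : 0 < g%:R :> R by rewrite ltr0n.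
have lg : 0 <= ln (g%:R : R) by rewrite ln_ge0 // ler1n.
have l2 : 0 < ln (2 : R) by rewrite ln_gt0 // ltr1n.
have -> : (64 * g%:Z ^+ 6)%:~R = 2 ^+ 6 * g%:R ^+ 6 :> R.
  by rewrite rmorphM rmorphXn /=; congr (_ * _); rewrite -natrX.
rewrite lnM ?posrE ?exprn_gt0 // !lnXn //.
case: ifP => _.
  rewrite natrM natrX (_ : 32%:R = 2 ^+ 5 :> R); last by rewrite -natrX.
  rewrite lnM ?posrE ?exprn_gt0 // !lnXn //; field.
  by rewrite gt_eqF //; lra.
rewrite natrM natrX (_ : 16%:R = 2 ^+ 4 :> R); last by rewrite -natrX.
rewrite lnM ?posrE ?exprn_gt0 // !lnXn //; field.
by rewrite gt_eqF //; lra.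
Qed.

End CongruentJacobian.

(** * The parity descent curve *)

(** [a = b] would make the coprime pair [(1, 1)]. *)
Lemma parityGamma_neq0 a b c da ua db ub : parity_class_triple a b c ->
  (a, b, c) <> (1, 1, 2)%N -> squarefree_decomposition a da ua ->
  squarefree_decomposition b db ub -> parityGamma a b da db != 0.
Proof.
move=> [[a0 b0 _] [cab _ _] abc [oa ob _]] ne [[da0 _] _ _] [[db0 _] _ _].
have ab : a <> b.
  move=> ab; case: ne; move: cab; rewrite -abc -ab /coprime gcdnn => /eqP ->.
  by [].
rewrite /parityGamma /parityK /parityM !mulf_eq0 !negb_or.
by move: a0 b0 oa ob ab da0 db0; clear; lia.
Qed.

Theorem corollary8p13 (R : realType) (a b c da ua db ub : nat) (Szp : R)
    (hT : parity_class_triple a b c) (hT1 : (a, b, c) <> (1, 1, 2)%N)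
    (ha : squarefree_decomposition a da ua)
    (hb : squarefree_decomposition b db ub)
    (hS : szpiro_quotient (quadric_jacobian (parity_descent_curve a b da db)) Szp) :
  let gamma : nat := squarefree_part `|parityGamma a b da db|%N in
  Szp < 3 /\
  Szp = if odd gamma
        then 3 - 9 * ln 2 / (2 * ln gamma%:R + 5 * ln 2)
        else 3 - 6 * ln 2 / (2 * ln gamma%:R + 4 * ln 2).
Proof.
move=> gamma; move: hS; rewrite quadric_jacobian_parity_descent_curve.
have G0 := parityGamma_neq0 hT hT1 ha hb.
set G := parityGamma a b da db in G0 gamma *.
have [|sf [k k0 Gk]] := @squarefree_partP `|G|%N; first by rewrite absz_gt0.
rewrite -/gamma in sf Gk.
have kE : absz (sgz G * gamma%:Z) = gamma by rewrite abszM; case: sgzP G0 => //; rewrite mul1n.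
have h0 : 2 * k%:R != 0 :> rat by rewrite mulf_neq0 // pnatr_eq0 -lt0n.
have -> : - (16 * G%:~R ^+ 2) = - ((2 * k%:R) ^+ 2 * (sgz G * gamma%:Z)%:~R) ^+ 2 :> rat.
  have GE : G = sgz G * gamma%:Z * k%:Z ^+ 2.
    by rewrite {1}[G]intEsg Gk; rewrite PoszM; rewrite mulrA.
  by rewrite {1}GE !(rmorphM, rmorphXn) /=; ring.
move=> /(szpiro_congruent sf kE h0) SE; split=> //; rewrite SE.
have lg : 0 <= ln (gamma%:R : R) by rewrite ln_ge0 // ler1n; case: sf.
have l2 : 0 < ln (2 : R) by rewrite ln_gt0 // ltr1n.
by case: ifP => _; rewrite ltrBlDr ltrDl divr_gt0 //; lra.
Qed.
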